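(* Let $\Omega\subset\mathbb{R}^{n+1}$, $n\ge2$, be an open set, let $L=-\operatorname{div}(A\nabla)$ be a real (not necessarily symmetric) elliptic operator with elliptic measure $\omega_L$, and let $\alpha\in(0,1)$. Suppose there is a constant $C_\alpha$ such that for every $f\in\dot{\mathscr C}^\alpha(\partial\Omega)$ the function $u$ defined by $$u(X)=\int_{\partial\Omega}f(y)\,d\omega_L^X(y),\qquad X\in\Omega,$$ in the case that $\Omega$ is bounded or $\Omega$ is unbounded with $\partial\Omega$ unbounded, or defined, for every $y_0\in\partial\Omega$, by $$u(X)=f(y_0)+\int_{\partial\Omega}(f(y)-f(y_0))\,d\omega_L^X(y),\qquad X\in\Omega,$$ in the case that $\Omega$ is unbounded with $\partial\Omega$ bounded, is given by an absolutely convergent integral, is a solution to the problem $$u\in W^{1,2}_{\mathrm{loc}}(\Omega),\qquad Lu=0 \text{ in the weak sense in }\Omega,\qquad u\in\dot{\mathscr C}^\alpha(\Omega),\qquad u|_{\partial\Omega}=f,$$ and satisfies $$\|u\|_{\dot{\mathscr C}^\alpha(\Omega)}\le C_\alpha\|f\|_{\dot{\mathscr C}^\alpha(\partial\Omega)}.$$ Then $\Omega$ satisfies the capacity density condition, with constant depending only on $n$, the ellipticity of $L$, $\alpha$, and $C_\alpha$.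
   Context: Hölder spaces: for $E\subset\mathbb{R}^{n+1}$ and $\alpha\in(0,1)$, $\dot{\mathscr C}^\alpha(E)$ is the set of $u:E\to\mathbb{R}$ with $\|u\|_{\dot{\mathscr C}^\alpha(E)}:=\sup_{X\ne Y\in E}\frac{|u(X)-u(Y)|}{|X-Y|^\alpha}<\infty$. A function $u\in\dot{\mathscr C}^\alpha(\Omega)$ extends continuously to $\overline\Omega$ (the extension is still called $u$), and $u|_{\partial\Omega}$ is the restriction of this extension to $\partial\Omega$. Capacity: for an open set $D\subset\mathbb{R}^{n+1}$ and compact $K\subset D$, $\operatorname{Cap}(K,D):=\inf\{\iint_D|\nabla v|^2\,dX: v\in\mathscr C_c^\infty(D),\ v\ge1\text{ in }K\}$. CDC: $\Omega$ satisfies the capacity density condition if there is $c_1>0$ (the CDC constant) such that $\operatorname{Cap}(\overline{B(x,r)}\setminus\Omega,B(x,2r))\ge c_1\operatorname{Cap}(\overline{B(x,r)},B(x,2r))$ for all $x\in\partial\Omega$ and $0<r<\operatorname{diam}(\partial\Omega)$. Elliptic operators: $L=-\operatorname{div}(A\nabla)$ with $A$ a real (not necessarily symmetric) $(n+1)\times(n+1)$ matrix with entries in $L^\infty(\Omega)$ and such that, for some $\Lambda\ge1$ (the ellipticity constant), $\Lambda^{-1}|\xi|^2\le A(X)\xi\cdot\xi$ and $|A(X)\xi\cdot\eta|\le\Lambda|\xi||\eta|$ for all $\xi,\eta\in\mathbb{R}^{n+1}$ and a.e. $X\in\Omega$. $Lu=0$ in the weak sense in $\Omega$ means $u\in W^{1,2}_{\mathrm{loc}}(\Omega)$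 and $\iint_\Omega A\nabla u\cdot\nabla\phi\,dX=0$ for all $\phi\in\mathscr C_c^\infty(\Omega)$; weak solutions are identified with their continuous representatives. Elliptic measure $\{\omega_L^X\}_{X\in\Omega}$: if $\Omega$ is bounded, for Lipschitz $f$ on $\partial\Omega$ let $u_f$ be the weak solution of $Lu_f=0$ in $\Omega$ with $u_f-F\in W^{1,2}_0(\Omega)$, where $F$ is any Lipschitz extension of $f$; then $\omega_L^X$ is the Borel measure on $\partial\Omega$ with $u_f(X)=\int_{\partial\Omega}f\,d\omega_L^X$ for all such $f$. If $\Omega$ is unbounded, $\omega_L^X$ is the Borel measure on $\partial\Omega$ with $\int f\,d\omega_L^X=\lim_{N\to\infty}\int f\,d\omega_{L,\Omega\cap B(0,N)}^X$ for all compactly supported Lipschitz $f$ on $\partial\Omega$ (with $f$ extended by $0$ to the rest of $\partial(\Omega\cap B(0,N))$), where $\omega_{L,D}$ denotes elliptic measure relative to $D$. *)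

(* Defs.v *)
From HB Require Import structures.
From mathcomp Require Import all_boot all_order all_algebra.
From mathcomp Require Import all_classical all_reals all_analysis.
From mathcomp Require Import measurable_realfun lebesgue_integral_fubini.

Set Implicit Arguments.
Unset Strict Implicit.
Unset Printing Implicit Defensive.

Import Order.TTheory GRing.Theory Num.Theory.
Import numFieldNormedType.Exports.

Local Open Scope classical_set_scope.
Local Open Scope ring_scope.

(* Points of R^d are row vectors 'rV[R]_d. Their library topology is induced
   by the sup norm, which defines the same open, bounded and compact sets and the
   same Lipschitz functions as the Euclidean norm [enorm]; all quantitative
   metric notions below use [enorm]. [borel R d] is the same carrier with its Borel sigma-algebra. *)
Notation borel R d := (g_sigma_algebraType (@open 'rV[R]_d)).

Section lebesgue.
Context {R : realType}.

Lemma measurable_fun_borel d' (T : measurableType d') (d : nat)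
    (f : T -> borel R d) :
  (forall i, measurable_fun setT (fun t => (f t : 'rV[R]_d) ord0 i)) ->
  measurable_fun setT f.
Proof.
move=> mf; apply: (@measurability _ _ _ _ _ f open) => // _ [U oU <-].
pose B (p : 'rV[rat]_d * nat) : set 'rV[R]_d := ball (map_mx ratr p.1 : 'rV[R]_d) p.2.+1%:R^-1.
pose I : set ('rV[rat]_d * nat) := [set p | B p `<=` U].
have -> : U = \bigcup_(p in I) B p.
  apply/seteqP; split => [x Ux|x [p]]; last exact.
  have /nbhs_ballP[e /= e0 eU] := open_nbhs_nbhs (conj oU Ux).
  have [k _ /(_ k (leqnn _)) /= ke] := near_infty_natSinv_lt (PosNum (divr_gt0 e0 (@ltr0n R 2))).
  have k0 : 0 < k.+1%:R^-1 :> R by rewrite invr_gt0.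
  have qP i : exists q : rat, ball (x ord0 i) k.+1%:R^-1 (ratr q : R).
    have [|q] := @rat_in_itvoo R (x ord0 i - k.+1%:R^-1) (x ord0 i + k.+1%:R^-1).
      by rewrite ltrD2l gtrN.
    by rewrite in_itv /= => h; exists q; rewrite /ball /= ltr_distlC.
  have [q qE] := choice qP.
  have bq : ball (map_mx ratr (\row_i q i) : 'rV[R]_d) k.+1%:R^-1 x.
    by split => // i j; rewrite !mxE (ord1 i); apply: ball_sym; exact: qE.
  exists (\row_i q i, k) => //= y /= By; apply: eU.
  apply: (@le_ball _ _ x (k.+1%:R^-1 + k.+1%:R^-1)).
    by rewrite [leRHS]splitr; apply: lerD; exact: ltW.
  exact: ball_triangle (ball_sym bq) By.
rewrite setTI preimage_bigcup bigcup_mkcond.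
apply: countable_bigcupT_measurable => [|p]; first exact: countableP.
case: ifP => // _.
have -> : f @^-1` B p = \bigcap_(i in [set: 'I_d])
   ((fun t => (f t : 'rV[R]_d) ord0 i) @^-1` ball (ratr (p.1 ord0 i) : R) p.2.+1%:R^-1).
  apply/seteqP; split => [t /= [_ h] i _ /=|t /= h]; first by have := h ord0 i; rewrite !mxE.
  by split; [rewrite invr_gt0 | move=> i j; rewrite !mxE (ord1 i); exact: h].
apply: fin_bigcap_measurable => // i _.
rewrite -[X in measurable X]setTI; apply: mf => //.
by rewrite ball_itv; exact: measurable_itv.
Qed.

Lemma measurable_coord (d : nat) (i : 'I_d) :
  measurable_fun setT (fun x : borel R d => (x : 'rV[R]_d) ord0 i).
Proof.
apply: (measurability _ (RGenOpens.measurableE R)) => _ [_ [a [b ->]] <-].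
rewrite setTI; apply: sub_sigma_algebra.
by apply: open_comp; [move=> x _; exact: coord_continuous | exact: interval_open].
Qed.

Definition rV_cons (d : nat) (p : R * borel R d) : borel R d.+1 :=
  \row_i oapp ((p.2 : 'rV[R]_d) ord0) p.1 (unlift ord0 i).

Definition rV_uncons (d : nat) (x : borel R d.+1) : R * borel R d :=
  ((x : 'rV[R]_d.+1) ord0 ord0, \row_i (x : 'rV[R]_d.+1) ord0 (lift ord0 i)).

Lemma rV_uncons_consK d : cancel (@rV_cons d) (@rV_uncons d).
Proof.
move=> [t y]; rewrite /rV_uncons /rV_cons !mxE unlift_none; congr pair.
by apply/rowP => i; rewrite !mxE liftK.
Qed.

Lemma measurable_rV_cons d : measurable_fun setT (@rV_cons d).
Proof.
apply: measurable_fun_borel => i; rewrite /rV_cons.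
case: (unliftP ord0 i) => [j ->|->].
  under eq_fun do rewrite mxE liftK /=.
  exact: (measurableT_comp (measurable_coord j) measurable_snd).
under eq_fun do rewrite mxE unlift_none /=.
exact: measurable_fst.
Qed.

Lemma measurable_rV_uncons d : measurable_fun setT (@rV_uncons d).
Proof.
apply/measurable_fun_pairP; split; first exact: measurable_coord.
apply: measurable_fun_borel => i /=.
under eq_fun do rewrite mxE.
exact: measurable_coord.
Qed.

(* The library's sigma-finite instance of [_ \x _] is shadowed by its
   subprobability instance. *)
Lemma sigma_finite_product d1 d2 (T1 : measurableType d1)
    (T2 : measurableType d2) (m1 : {sigma_finite_measure set T1 -> \bar R})
    (m2 : {sigma_finite_measure set T2 -> \bar R}) :
  sigma_finite setT (m1 \x m2)%E.
Proof.
have /sigma_finiteP[F [TF ndF Foo]] := sigma_finiteT m1.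
have /sigma_finiteP[G [TG ndG Goo]] := sigma_finiteT m2.
exists (fun k => F k `*` G k).
  rewrite -setXTT TF TG; apply/seteqP; split => [[x y]|[x y] [k _ []]] /=.
    move=> [[k _ Fkx] [l _ Gly]]; exists (maxn k l) => //; split.
    - by move: x Fkx; exact/subsetPset/ndF/leq_maxl.
    - by move: y Gly; exact/subsetPset/ndG/leq_maxr.
  by move=> *; split; exists k.
move=> k; have [mF Fk] := Foo k; have [mG Gk] := Goo k.
split; first exact: measurableX.
by rewrite product_measure1E// lte_mul_pinfty// ge0_fin_numE.
Qed.

Definition lebesgue_cons (d : nat)
    (mu : {sigma_finite_measure set (borel R d) -> \bar R}) :
    set (borel R d.+1) -> \bar R :=
  pushforward (lebesgue_measure \x mu)%E (@rV_cons d).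

Section lebesgue_cons.
Variables (d : nat) (mu : {sigma_finite_measure set (borel R d) -> \bar R}).

#[local] Hint Extern 0 (measurable_fun _ _) =>
  solve [exact: measurable_rV_cons] : core.

Let lebesgue_cons0 : lebesgue_cons mu set0 = 0%E.
Proof. exact: measure0. Qed.

Let lebesgue_cons_ge0 A : (0 <= lebesgue_cons mu A)%E.
Proof. exact: measure_ge0. Qed.

Let lebesgue_cons_sigma_additive : semi_sigma_additive (lebesgue_cons mu).
Proof. exact: measure_semi_sigma_additive. Qed.

HB.instance Definition _ := isMeasure.Build _ _ _ (lebesgue_cons mu)
  lebesgue_cons0 lebesgue_cons_ge0 lebesgue_cons_sigma_additive.

Let lebesgue_cons_sigma_finite : sigma_finite setT (lebesgue_cons mu).
Proof.
have [F FT Foo] := sigma_finite_product lebesgue_measure mu.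
exists (fun k => @rV_uncons d @^-1` F k).
  by rewrite -preimage_bigcup -FT preimage_setT.
move=> k; have [mF Fk] := Foo k; split.
  by rewrite -[X in measurable X]setTI; exact: measurable_rV_uncons.
rewrite /lebesgue_cons /pushforward -comp_preimage.
by rewrite (_ : _ \o _ = id) ?preimage_id//; apply/funext/rV_uncons_consK.
Qed.

HB.instance Definition _ := @Measure_isSigmaFinite.Build _ _ _
  (lebesgue_cons mu) lebesgue_cons_sigma_finite.
End lebesgue_cons.

(* Lebesgue measure of R^d on Borel sets: the image of the d-fold product of
   [lebesgue_measure]. *)
Fixpoint lebesgue_rV (d : nat) :
    {sigma_finite_measure set (borel R d) -> \bar R} :=
  if d is d'.+1 then lebesgue_cons (lebesgue_rV d')
  else dirac ((0 : 'rV[R]_0) : borel R 0).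

Lemma lebesgue_rV_box (d : nat) (B : 'I_d -> set R) :
  (forall i, measurable (B i)) ->
  lebesgue_rV d [set x : 'rV[R]_d | forall i, B i (x ord0 i)] =
  (\prod_(i < d) lebesgue_measure (B i))%E.
Proof.
elim: d B => [|d IH] B mB.
  by rewrite big_ord0 /= diracE mem_set//= => -[].
rewrite big_ord_recl -(IH (fun i => B (lift ord0 i)))//.
set S := [set x : 'rV[R]_d | _].
have mS : measurable (S : set (borel R d)).
  rewrite (_ : S = \bigcap_(i in [set: 'I_d])
      ((fun x : borel R d => (x : 'rV[R]_d) ord0 i) @^-1` B (lift ord0 i))).
    apply: fin_bigcap_measurable => // i _.
    by rewrite -[X in measurable X]setTI; exact: measurable_coord.
  by apply/seteqP; split => [x /= h i _|x /= h i]; exact: h.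
transitivity ((lebesgue_measure \x lebesgue_rV d)%E (B ord0 `*` S)); last first.
  by apply: product_measure1E => //; exact: mB.
rewrite /= /lebesgue_cons /pushforward.
apply: (congr1 (product_measure1 _ _)).
apply/seteqP; split => [[t y] h|[t y] [/= Bt By] i]; rewrite /rV_cons.
  split => [|i] /=; [have := h ord0|have := h (lift ord0 i)].
    by rewrite /rV_cons mxE unlift_none.
  by rewrite /rV_cons mxE liftK.
by rewrite mxE; case: unliftP => [j ->|->].
Qed.

End lebesgue.

Arguments lebesgue_rV {R} d.

Section definitions.
Context {R : realType} {d : nat}.
Local Notation pt := 'rV[R]_d.
Local Notation leb := (@lebesgue_rV R d).
Implicit Types (D E K : set pt) (f u v F phi : pt -> R) (g : pt -> pt).
Implicit Types (A : pt -> 'M[R]_d) (w : pt -> {measure set (borel R d) -> \bar R}).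

Definition edot (x y : pt) : R := \sum_i x ord0 i * y ord0 i.

Definition enorm (x : pt) : R := Num.sqrt (edot x x).

Definition eball (x : pt) (r : R) : set pt := [set y | enorm (y - x) < r].

Definition bd E : set pt := closure E `\` interior E.

Definition ediam E : \bar R :=
  ereal_sup [set (enorm (x - y))%:E | x in E & y in E].

(* The adjoined 0 makes the seminorm vanish when E has at most one point. *)
Definition hoelder_seminorm (alpha : R) E u : \bar R :=
  ereal_sup ([set 0%E] `|`
    [set (`|u p.1 - u p.2| / enorm (p.1 - p.2) `^ alpha)%:E
      | p in [set p : pt * pt | [/\ E p.1, E p.2 & p.1 != p.2]]]).

Definition hoelder_class (alpha : R) E u : Prop :=
  (hoelder_seminorm alpha E u < +oo)%E.

(* The continuous extension of u to the closure of D equals f on bd D. *)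
Definition boundary_values D u f : Prop :=
  exists U : pt -> R, [/\ {within closure D, continuous U},
    forall X, D X -> U X = u X & forall y, bd D y -> U y = f y].

Definition partial (i : 'I_d) f : pt -> R := 'D_(delta_mx ord0 i) f.

Definition grad f (x : pt) : pt := \row_i partial i f x.

(* C^oo: every iterated partial derivative exists and is continuous. *)
Definition smooth f : Prop := forall s : seq 'I_d,
  continuous (foldr partial f s) /\
  (forall i x, derivable (foldr partial f s) x (delta_mx ord0 i)).

Definition supp f : set pt := closure [set x | f x != 0].

Definition test_function D phi : Prop :=
  [/\ smooth phi, compact (supp phi) & supp phi `<=` D].

Definition capacity K D : \bar R :=
  ereal_inf [set (\int[leb]_(x in D) (enorm (grad v x) ^+ 2)%:E)%E
    | v in [set v | test_function D v /\ (forall x, K x -> 1 <= v x)]].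

Definition capacity_density (c : R) D : Prop :=
  forall (x : pt) (r : R), bd D x -> 0 < r -> (r%:E < ediam (bd D))%E ->
  (c%:E * capacity (closure (eball x r)) (eball x (2 * r)) <=
   capacity (closure (eball x r) `\` D) (eball x (2 * r)))%E.

(* Classes of functions modulo null sets are represented by Borel functions. *)
Definition L2 D u : Prop := measurable_fun (D : set (borel R d)) u /\
  (\int[leb]_(x in D) (u x ^+ 2)%:E < +oo)%E.

Definition L2loc D u : Prop := measurable_fun (D : set (borel R d)) u /\
  forall K, compact K -> K `<=` D ->
  (\int[leb]_(x in K) (u x ^+ 2)%:E < +oo)%E.

Definition weak_gradient D u g : Prop :=
  forall (i : 'I_d) phi, test_function D phi ->
  \int[leb]_(x in D) (u x * partial i phi x) =
  - \int[leb]_(x in D) (g x ord0 i * phi x).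

(* u \in W^{1,2}_loc(D), with weak gradient g. *)
Definition W12loc D u g : Prop :=
  [/\ L2loc D u, (forall i, L2loc D (fun x => g x ord0 i))
    & weak_gradient D u g].

(* u \in W^{1,2}_0(D), the closure of the test functions in W^{1,2}(D). *)
Definition W120 D u : Prop := exists g : pt -> pt,
  [/\ L2 D u, (forall i, L2 D (fun x => g x ord0 i)), weak_gradient D u g
    & forall e : R, 0 < e -> exists2 phi, test_function D phi &
      (\int[leb]_(x in D)
        (((u x - phi x) ^+ 2 + enorm (g x - grad phi x) ^+ 2)%:E) < e%:E)%E].

(* In row-vector convention A(X) xi is xi *m (A X)^T. The entries of A are in
   L^oo(D): they are bounded a.e. by Lambda, by the last inequality. *)
Definition elliptic (Lambda : R) D A : Prop :=
  (forall i j, measurable_fun (D : set (borel R d)) (fun X => A X i j)) /\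
  {ae leb, forall X, D X ->
    (forall xi : pt,
       Lambda^-1 * enorm xi ^+ 2 <= edot (xi *m (A X)^T) xi) /\
    (forall xi eta : pt,
       `|edot (xi *m (A X)^T) eta| <= Lambda * enorm xi * enorm eta)}.

(* u \in W^{1,2}_loc(D) and div (A grad u) = 0 weakly in D. *)
Definition weak_solution A D u : Prop := exists2 g : pt -> pt,
  W12loc D u g & forall phi, test_function D phi ->
  \int[leb]_(X in D) edot (g X *m (A X)^T) (grad phi X) = 0.

(* The solution u_f for Lipschitz boundary data f, in its continuous
   representative. *)
Definition variational_solution A D f u : Prop :=
  [/\ {within D, continuous u}, weak_solution A D u
    & forall F, [lipschitz F x | x in closure D] ->
      (forall y, bd D y -> F y = f y) -> W120 D (u \- F)].

(* A measure w X on bd D is represented by a Borel measure on R^d of which only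
   the restriction to bd D matters. *)
Definition elliptic_measure_bounded A D w : Prop :=
  forall f, [lipschitz f x | x in bd D] ->
  exists2 u, variational_solution A D f u &
    forall X, D X -> (\int[w X]_(y in bd D) (f y)%:E = (u X)%:E)%E.

Definition elliptic_measure A D w : Prop :=
  (bounded_set D -> elliptic_measure_bounded A D w) /\
  (~ bounded_set D ->
   let DN N := D `&` eball 0 N%:R in
   exists2 wN : nat -> pt -> {measure set (borel R d) -> \bar R},
     (forall N, elliptic_measure_bounded A (DN N) (wN N)) &
     forall X f, D X -> [lipschitz f x | x in bd D] ->
       compact (closure [set y | bd D y /\ f y != 0]) ->
       (\int[wN N X]_(y in bd (DN N)) ((f \_ (bd D)) y)%:E)%E @[N --> \oo] -->
       (\int[w X]_(y in bd D) (f y)%:E)%E).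

Definition hoelder_solution A D (alpha C : R) f u : Prop :=
  [/\ weak_solution A D u, hoelder_class alpha D u, boundary_values D u f
    & (hoelder_seminorm alpha D u <= C%:E * hoelder_seminorm alpha (bd D) f)%E].

End definitions.

(* Main.v *)
(* Let [x] be a boundary point, [r < diam], and let [v] be a test function for the
   capacity of [K = cl B(x,r) \ Omega] in [B(x,2r)].  Take a bump [f] on [B(x,r/2)] with
   [f x = 1]; it vanishes at some boundary point, so in all cases the hypothesis
   concerns [u = \int f dw], which is Hoelder with constant [~ r^-alpha] and equals 1
   at [x]: hence [u >= 5/8] on [Omega] near [x], at scale [delta r].
   Since [v >= 1] on [K], [F = f h(v)] with [h 0 = 0] and [h = 1] on [[1,oo)] has
   the boundary values of [f], so [u] is the variational solution with data [F] (or a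
   limit of such solutions on [Omega] cut by balls), and its energy, hence
   that of its extension by [F], is at most a constant times the energy of [F], which
   is controlled by that of [v].  This extension is at least 1/2 on the whole
   ball [B(x, delta r)], so Hardy's inequality, which needs dimension at least 3, bounds
   the energy of [v] from below by [c r^(d-2)]. *)
From HB Require Import structures.
From mathcomp Require Import all_boot all_order all_algebra.
From mathcomp Require Import all_classical all_reals all_analysis.
From mathcomp Require Import measurable_realfun lebesgue_integral_fubini.
From mathcomp Require Import ring lra.
Require Import Defs.

Set Implicit Arguments.
Unset Strict Implicit.
Unset Printing Implicit Defensive.

Import Order.TTheory GRing.Theory Num.Theory.
Import numFieldNormedType.Exports.

Local Open Scope classical_set_scope.
Local Open Scope ring_scope.

(** * Integration of derivatives over R^d *)

(** [A] need not be symmetric, so the energy bound cannot come from minimality of [u]; it comes from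
    testing the equation against functions [phi] that approximate [u - F] in [W^{1,2}], as [W120]
    provides. The extension of [u] by [F] is accordingly never given a gradient: [F + phi] is [C1]
    on the whole space, and Hardy's inequality, needed only for compactly supported [C1] functions,
    turns its energy into an [L^2] bound on the small ball. In the unbounded case the solutions on
    the cut domains converge merely pointwise; the [L^2] bound still passes to the limit once the
    integrand is truncated at 1/4, without weak compactness. [weak_solution] and [W120] each carry
    their own weak gradient, and these must be shown to agree almost everywhere. The datum [F] must
    at once be Lipschitz and compactly supported, to be admissible for elliptic measure, and have
    energy controlled by that of [v]: the gradient of the bump costs [v^2 / r^2], which Hardy's
    inequality on [B(x,2r)] absorbs. The density condition then follows from an upper bound of the
    same order [r^(d-2)] for the capacity of the full ball. *)

Section line.
Context {R : realType} {U V W : normedModType R}.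

(** The two difference quotients are the same function of [h], so no derivability is assumed. This
    moves partial derivatives to coordinate lines and slices. *)
Lemma derive_affine (f : V -> W) (p : U -> V) (a u : U) (v : V) :
  (forall h : R, p (h *: u + a) = h *: v + p a) ->
  'D_u (f \o p) a = 'D_v f (p a).
Proof.
move=> pE; rewrite /derive; set F := (X in X @ _); set G := (X in _ = lim (X @ _)).
by have -> : F = G by apply/funext => h; rewrite /F /G /= pE.
Qed.

Lemma derivable_affine (f : V -> W) (p : U -> V) (a u : U) (v : V) :
  (forall h : R, p (h *: u + a) = h *: v + p a) ->
  derivable (f \o p) a u <-> derivable f (p a) v.
Proof.
move=> pE; rewrite /derivable; set F := (X in cvg (X @ _)); set G := (X in _ <-> cvg (X @ _)).
by have -> : F = G by apply/funext => h; rewrite /F /G /= pE.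
Qed.
End line.

Section basics.
Context {R : realType}.
Implicit Types d : nat.

Lemma measurable_open d (U : set 'rV[R]_d) : open U ->
  measurable (U : set (borel R d)).
Proof. by move=> oU; exact: sub_sigma_algebra. Qed.

Lemma measurable_closed d (U : set 'rV[R]_d) : closed U ->
  measurable (U : set (borel R d)).
Proof.
move=> cU; rewrite -(setCK U).
exact: (measurableC (measurable_open (closed_openC cU))).
Qed.

Lemma measurable_continuous d (f : 'rV[R]_d -> R) : continuous f ->
  measurable_fun setT (fun x : borel R d => f x).
Proof.
move=> cf; apply: (measurability _ (RGenOpens.measurableE R)) => _ [_ [a [b ->]] <-].
rewrite setTI; apply: measurable_open.
by apply: open_comp; [move=> x _; exact: cf | exact: interval_open].
Qed.

(** Compact support in a form that is inherited by coordinate slices, as the induction on the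
    dimension in [integral_partial] requires. *)
Definition boxed d (M : R) (f : 'rV[R]_d -> R) :=
  forall (x : 'rV[R]_d) i, M < `|x ord0 i| -> f x = 0.

Definition cube d (M : R) : set 'rV[R]_d := [set x : 'rV[R]_d | forall i, `[- M, M]%classic (x ord0 i)].

Lemma compact_cube d M : compact (@cube d M).
Proof. exact: (@rV_compact _ _ (fun=> `[- M, M]%classic) (fun=> @segment_compact _ _ _)). Qed.

Lemma measurable_cube d M : measurable (@cube d M : set (borel R d)).
Proof. by apply: measurable_closed; apply: compact_closed; [exact: norm_hausdorff|exact: compact_cube]. Qed.

Lemma cube_lty d M : (lebesgue_rV d (@cube d M) < +oo)%E.
Proof.
pose I : set R := `[- M, M]%classic.
rewrite /cube (@lebesgue_rV_box R d (fun=> I))//.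
suff : (\prod_(i < d) lebesgue_measure I)%E \is a fin_num by move/fin_numPlt/andP => [].
elim/big_ind : _ => // [x y|i _]; first exact: fin_numM.
  by rewrite /I lebesgue_measure_itv; case: ifP => // _; rewrite -EFinB.
by move=> _; exact: measurable_itv.
Qed.

Lemma boxedP d M (f : 'rV[R]_d -> R) : boxed M f <-> (forall x, ~ cube M x -> f x = 0).
Proof.
split => [bf x|bf x i xi].
  move=> /existsNP[i]; rewrite /= in_itv /= => /negP; rewrite -ler_norml -ltNge; exact: bf.
apply: bf => cx; have := cx i.
by rewrite /= in_itv /= -ler_norml leNgt xi.
Qed.

Lemma boxed_bounded d M (f : 'rV[R]_d -> R) : continuous f -> boxed M f ->
  exists2 B : R, 0 < B & forall x, `|f x| <= B.
Proof.
move=> cf /boxedP bf.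
have [B [_ HB]] : bounded_set (f @` (cube M : set ('rV[R]_d))).
  apply: compact_bounded; apply: continuous_compact; last exact: compact_cube.
  exact: continuous_subspaceT.
have HB1 := HB (`|B| + 1) (ltr_pwDr ltr01 (ler_norm B)).
exists (`|B| + 1) => [|x]; first by rewrite ltr_wpDl.
have [cx|ncx] := pselect (cube M x); first by apply: HB1; exists x.
by rewrite bf// normr0 addr_ge0.
Qed.

Lemma boxed_integrable d M (f : 'rV[R]_d -> R) : continuous f -> boxed M f ->
  (lebesgue_rV d).-integrable setT (fun x : borel R d => (f x)%:E).
Proof.
move=> cf bf; have [B B0 fB] := boxed_bounded cf bf.
have mf := measurable_continuous cf.
have mc := @measurable_cube d M.
have -> : (fun x : borel R d => (f x)%:E) = (fun x : borel R d => (f x)%:E) \_ (cube M : set (borel R d)).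
  apply/funext => x; rewrite patchE; case: ifPn => // /negP; rewrite inE => /= nc.
  by move/boxedP : bf => ->.
apply/(integrable_mkcond _ mc); apply: measurable_bounded_integrable => //.
- exact: cube_lty.
- exact: measurable_funTS.
- exists B; split => [|y By x _ /=]; first exact: num_real.
  by rewrite (le_trans (fB x)) ?ltW.
Qed.

Definition C1 d (f : 'rV[R]_d -> R) := continuous f /\
  forall i, (forall x, derivable f x (delta_mx ord0 i)) /\ continuous (partial i f).

Lemma boxed_partial d M (f : 'rV[R]_d -> R) i : boxed M f -> boxed M (partial i f).
Proof.
move=> bf x j xj; rewrite /partial.
rewrite (@near_eq_derive _ _ _ f (cst 0)) ?derive_cst//.
have : open [set y : 'rV[R]_d | M < `|y ord0 j|].
  apply: (@open_comp _ _ (fun y : 'rV[R]_d => `|y ord0 j|) [set z | M < z]).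
    by move=> y _; apply: continuous_comp; [exact: coord_continuous|exact: norm_continuous].
  exact: open_gt.
move=> oA; near=> y; apply: (bf y j).
near: y; exact: (open_nbhs_nbhs (conj oA xj)).
Unshelve. all: end_near. Qed.

Lemma C1_integrable_partial d M (f : 'rV[R]_d -> R) i : C1 f -> boxed M f ->
  (lebesgue_rV d).-integrable setT (fun x : borel R d => (partial i f x)%:E).
Proof. by move=> [_ /(_ i)[_ cf]] /(boxed_partial i); exact: boxed_integrable. Qed.

Lemma continuous_rV_consr d (t : R) : continuous (fun y : 'rV[R]_d => rV_cons (t, y) : 'rV[R]_d.+1).
Proof.
move=> y A /nbhs_ballP[e /= e0 eA]; apply/nbhs_ballP; exists e => // z [_ yz].
apply: eA; split=> // i j; rewrite !mxE; case: unliftP => [k _|_] /=; first exact: yz.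
exact: ballxx.
Qed.

Lemma continuous_rV_consl d (y : 'rV[R]_d) : continuous (fun t : R => rV_cons (t, y) : 'rV[R]_d.+1).
Proof.
move=> t A /nbhs_ballP[e /= e0 eA]; apply/nbhs_ballP; exists e => // z tz.
apply: eA; split=> // i j; rewrite !mxE; case: unliftP => [k _|_] //=.
exact: ballxx.
Qed.

Lemma rV_cons_line0 d (y : 'rV[R]_d) (t h : R) :
  rV_cons (h *: 1 + t, y) = h *: delta_mx ord0 ord0 + rV_cons (t, y) :> 'rV[R]_d.+1.
Proof.
apply/rowP => i; rewrite !mxE; case: unliftP => [j|] ->/=.
  by rewrite mulr0 add0r.
by [].
Qed.

Lemma rV_cons_line d (y : 'rV[R]_d) (t h : R) (j : 'I_d) :
  rV_cons (t, h *: delta_mx ord0 j + y) = h *: delta_mx ord0 (lift ord0 j) + rV_cons (t, y) :> 'rV[R]_d.+1.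
Proof.
apply/rowP => i; rewrite !mxE; case: unliftP => [k|] ->/=.
  by rewrite !mxE !eqxx /= (inj_eq lift_inj).
by rewrite mulr0 add0r.
Qed.

Lemma integral_derive_R (H : R -> R) M : (forall x, derivable H x 1) -> continuous ('D_1 H) ->
  (forall t, M < `|t| -> H t = 0) ->
  (\int[lebesgue_measure]_t ('D_1 H t)%:E = 0)%E.
Proof.
move=> dH cH H0; pose N := `|M| + 1.
have MN : M < N by rewrite /N (le_lt_trans (ler_norm M))// ltrDl.
have N0 : 0 < N by rewrite /N ltr_wpDl.
have H0N t : N < `|t| -> 'D_1 H t = 0.
  move=> Nt; rewrite (@near_eq_derive _ _ _ H (cst 0)) ?derive_cst//.
  have oA : open [set s : R | N < `|s|].
    by apply: (@open_comp _ _ (fun s : R => `|s|) [set z | N < z]) => [s _|];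
      [exact: norm_continuous|exact: open_gt].
  near=> s; apply: H0; apply: (lt_trans MN).
  near: s; exact: (open_nbhs_nbhs (conj oA Nt)).
transitivity (\int[lebesgue_measure]_(t in `[(- N)%R, N]) ('D_1 H t)%:E)%E.
  rewrite [RHS]integral_mkcond; apply: eq_integral => t _.
  rewrite patchE; case: ifPn => // /negP; rewrite inE /= in_itv /= => /negP.
  by rewrite -ler_norml -ltNge => /H0N ->.
have HN : H N = 0 by apply: H0; rewrite gtr0_norm.
have HNN : H (- N) = 0 by apply: H0; rewrite normrN gtr0_norm.
have cH1 : continuous H by move=> x; apply/differentiable_continuous/derivable1_diffP.
rewrite (@continuous_FTC2 _ _ H) ?HN ?HNN ?subee//.
- by rewrite gtrN.
- exact: continuous_subspaceT.
- by split => [x _||]; [exact: dH|exact/cvg_at_right_filter/cH1|exact/cvg_at_left_filter/cH1].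
- by move=> x _; rewrite derive1E.
Unshelve. all: end_near. Qed.

Lemma measurable_rV_consT d :
  measurable_fun [set: measurableTypeR R * borel R d] (@rV_cons R d).
Proof. exact: measurable_rV_cons. Qed.

Lemma ge0_integral_rV_cons d (f : borel R d.+1 -> \bar R) :
  measurable_fun setT f -> (forall x, 0 <= f x)%E ->
  (\int[lebesgue_rV d.+1]_x f x =
   \int[lebesgue_measure \x lebesgue_rV d]_z f (rV_cons z))%E.
Proof.
move=> mf f0.
have := @ge0_integral_pushforward _ _ _ _ R _ (@measurable_rV_consT d) (lebesgue_measure \x lebesgue_rV d)%E setT f.
by apply => // y _; exact: f0.
Qed.

Lemma integrable_rV_cons d (f : borel R d.+1 -> \bar R) :
  (lebesgue_rV d.+1).-integrable setT f ->
  (lebesgue_measure \x lebesgue_rV d)%E.-integrable setT (fun z : R * borel R d => f (rV_cons z)).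
Proof.
move=> /integrableP[mf foo]; apply/integrableP; split.
  refine (@measurableT_comp _ _ _ _ _ _ _ _ (@rV_cons R d) mf _).
  exact: measurable_rV_cons.
rewrite -(@ge0_integral_rV_cons _ (fun x => `|f x|%E))//.
exact: measurableT_comp.
Qed.

Lemma integral_rV_cons d (f : borel R d.+1 -> \bar R) :
  (lebesgue_rV d.+1).-integrable setT f ->
  (\int[lebesgue_rV d.+1]_x f x =
   \int[lebesgue_measure \x lebesgue_rV d]_z f (rV_cons z))%E.
Proof.
move=> intf; have /integrableP[mf _] := intf.
exact: (@integral_pushforward _ _ _ _ R _ (@measurable_rV_consT d) (lebesgue_measure \x lebesgue_rV d)%E setT f mf (integrable_rV_cons intf)).
Qed.

(** Induction on [d] with Fubini. For the first coordinate the inner integral is one-dimensional and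
    vanishes by the fundamental theorem of calculus; for any other coordinate the inner integral is
    over a slice, where the induction hypothesis applies. *)
Lemma integral_partial d M (f : 'rV[R]_d -> R) i : C1 f -> boxed M f ->
  (\int[lebesgue_rV d]_x (partial i f x)%:E = 0)%E.
Proof.
elim: d f i => [f []//|d IH f i Cf bf].
have intf := C1_integrable_partial i Cf bf.
have icons := integrable_rV_cons intf.
rewrite integral_rV_cons//.
have derE0 t y : partial ord0 f (rV_cons (t, y)) = 'D_1 (fun s => f (rV_cons (s, y))) t.
  by rewrite /partial -(@derive_affine R _ _ _ f (fun s => rV_cons (s, y)) t 1)// => h; exact: rV_cons_line0.
have derE t y j : partial (lift ord0 j) f (rV_cons (t, y)) = partial j (fun z => f (rV_cons (t, z))) y.
  by rewrite /partial -(@derive_affine R _ _ _ f (fun z => rV_cons (t, z)) y (delta_mx ord0 j))// => h; exact: rV_cons_line.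
case: (unliftP ord0 i) => [j ij|i0].
  rewrite -integral12_prod_meas1//.
  apply: integral0_eq => t _.
  rewrite /fubini_F /= ij.
  under eq_integral do rewrite derE.
  apply: IH.
  - split => [y|k].
      by apply: continuous_comp; [exact: continuous_rV_consr|exact: Cf.1].
    split => y.
      rewrite (@derivable_affine R _ _ _ f (fun z => rV_cons (t, z)) y (delta_mx ord0 k) (delta_mx ord0 (lift ord0 k))).
        exact: (Cf.2 _).1.
      by move=> h; exact: rV_cons_line.
    rewrite (_ : partial k _ = fun y => partial (lift ord0 k) f (rV_cons (t, y))); last first.
      by apply/funext => z; rewrite derE.
    by apply: continuous_comp; [exact: continuous_rV_consr|exact: (Cf.2 _).2].
  - move=> y k Mk; apply: (bf _ (lift ord0 k)); rewrite mxE liftK /=; exact: Mk.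
rewrite -integral21_prod_meas1//.
apply: integral0_eq => y _; rewrite /fubini_G /= i0.
under eq_integral do rewrite derE0.
apply: (@integral_derive_R _ M).
- move=> x; rewrite (@derivable_affine R _ _ _ f (fun s => rV_cons (s, y)) x 1 (delta_mx ord0 ord0)).
    exact: (Cf.2 _).1.
  by move=> h; exact: rV_cons_line0.
- have -> : 'D_(1 : R) (fun s : R => f (rV_cons (s, y))) =
    fun s => partial ord0 f (rV_cons (s, y)) by apply/funext => z; rewrite derE0.
  by move=> s; apply: continuous_comp; [exact: continuous_rV_consl|exact: (Cf.2 _).2].
- by move=> t Mt; apply: (bf _ ord0); rewrite mxE unlift_none.
Qed.
End basics.

(** * Euclidean norm and C^1 functions *)

Section continuity.
Context {R : realType} {T : topologicalType}.
Implicit Types f g : T -> R.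

Lemma contD f g : continuous f -> continuous g -> continuous (fun x => f x + g x).
Proof. by move=> cf cg x; exact: (@continuousD _ _ _ f g x (cf x) (cg x)). Qed.

Lemma contM f g : continuous f -> continuous g -> continuous (fun x => f x * g x).
Proof. by move=> cf cg x; exact: (@continuousM _ _ f g x (cf x) (cg x)). Qed.

Lemma contN f : continuous f -> continuous (fun x => - f x).
Proof. by move=> cf x; exact: (@continuousN _ _ _ f x (cf x)). Qed.

Lemma contV f : continuous f -> (forall x, f x != 0) -> continuous (fun x => (f x)^-1).
Proof. by move=> cf f0 x; exact: (@continuousV _ _ f x (f0 x) (cf x)). Qed.
End continuity.

Section C1_theory.
Context {R : realType} {d : nat}.
Implicit Types (f g : 'rV[R]_d -> R) (x y a : 'rV[R]_d) (i j : 'I_d).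

Lemma enorm_ge0 x : 0 <= enorm x. Proof. exact: sqrtr_ge0. Qed.

Lemma edot_ge0 x : 0 <= edot x x.
Proof. by apply: sumr_ge0 => i _; rewrite -expr2 sqr_ge0. Qed.

Lemma enormE x : enorm x ^+ 2 = \sum_i x ord0 i ^+ 2.
Proof. by rewrite sqr_sqrtr ?edot_ge0//; apply: eq_bigr => i _; rewrite expr2. Qed.

Lemma edot_le x y : edot x y <= enorm x * enorm y.
Proof.
have [x0|x0] := eqVneq (enorm x) 0.
  have : enorm x ^+ 2 = 0 by rewrite x0 expr0n.
  rewrite enormE => /eqP; rewrite psumr_eq0 => [/allP h|i _]; last exact: sqr_ge0.
  rewrite x0 mul0r /edot big1// => i _; have := h i (mem_index_enum _).
  by rewrite sqrf_eq0 => /eqP ->; rewrite mul0r.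
have [y0|y0] := eqVneq (enorm y) 0.
  have : enorm y ^+ 2 = 0 by rewrite y0 expr0n.
  rewrite enormE => /eqP; rewrite psumr_eq0 => [/allP h|i _]; last exact: sqr_ge0.
  rewrite y0 mulr0 /edot big1// => i _; have := h i (mem_index_enum _).
  by rewrite sqrf_eq0 => /eqP ->; rewrite mulr0.
have xp : 0 < enorm x by rewrite lt_neqAle eq_sym x0 enorm_ge0.
have yp : 0 < enorm y by rewrite lt_neqAle eq_sym y0 enorm_ge0.
(* The square of [|y| x - |x| y] expands to [2 |x| |y| (|x| |y| - x.y)]. Dividing by [|x| |y|] is
   the reason for treating null vectors first. *)
have : 0 <= \sum_i (enorm y * x ord0 i - enorm x * y ord0 i) ^+ 2.
  by apply: sumr_ge0 => i _; exact: sqr_ge0.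
have -> : \sum_i (enorm y * x ord0 i - enorm x * y ord0 i) ^+ 2 =
    enorm y ^+ 2 * (\sum_i x ord0 i ^+ 2) + enorm x ^+ 2 * (\sum_i y ord0 i ^+ 2)
    - 2 * enorm x * enorm y * edot x y.
  rewrite /edot !mulr_sumr -big_split/= -sumrB; apply: eq_bigr => i _; ring.
rewrite -!enormE => h.
rewrite -(ler_pM2l (mulr_gt0 xp yp)); lra.
Qed.

Lemma enormD x y : enorm (x + y) <= enorm x + enorm y.
Proof.
rewrite -(@ler_pXn2r _ 2)// ?nnegrE ?addr_ge0 ?enorm_ge0//.
have -> : enorm (x + y) ^+ 2 = enorm x ^+ 2 + 2 * edot x y + enorm y ^+ 2.
  rewrite !enormE /edot mulr_sumr -!big_split/=; apply: eq_bigr => i _; rewrite mxE; ring.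
have := edot_le x y; lra.
Qed.

Lemma enormN x : enorm (- x) = enorm x.
Proof. by congr Num.sqrt; apply: eq_bigr => i _; rewrite !mxE mulrNN. Qed.

Lemma enormB x y : enorm (x - y) = enorm (y - x).
Proof. by rewrite -enormN opprB. Qed.

Lemma enorm0 : enorm (0 : 'rV[R]_d) = 0.
Proof. by rewrite /enorm /edot big1 ?sqrtr0// => i _; rewrite mxE mul0r. Qed.

Lemma coord_le_enorm x i : `|x ord0 i| <= enorm x.
Proof.
rewrite -(@ler_pXn2r _ 2)// ?nnegrE ?enorm_ge0// enormE (bigD1 i)//= real_normK ?num_real//.
by rewrite lerDl sumr_ge0// => j _; exact: sqr_ge0.
Qed.

Lemma enorm_eq0 x : enorm x = 0 -> x = 0.
Proof.
move=> x0; apply/rowP => i; rewrite mxE; apply/eqP; rewrite -normr_le0 -x0.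
exact: coord_le_enorm.
Qed.

Lemma is_derive_coord x i j :
  is_derive x (delta_mx ord0 i) (fun y : 'rV[R]_d => y ord0 j) ((i == j)%:R : R).
Proof.
have cv : (fun h : R => h^-1 *: (((fun y : 'rV[R]_d => y ord0 j) \o shift x) (h *: delta_mx ord0 i) - x ord0 j))
    @ 0^' --> ((i == j)%:R : R).
  apply: (@cvg_trans _ ((fun=> (i == j)%:R : R) @ 0^')); last exact: cvg_cst.
  apply: near_eq_cvg; near=> h => /=.
  have h0 : h != 0 by near: h; exact: nbhs_dnbhs_neq.
  by rewrite !mxE eqxx /= addrK eq_sym; exact/esym/(mulKf h0).
by apply: DeriveDef; [apply/cvg_ex; exists (i == j)%:R; exact: cv|exact/cvg_lim/cv].
Unshelve. all: end_near. Qed.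

(** Here [f] has only a derivative in the direction [v]. Composing with the line [h *: v + x]
    reduces to one real variable, where derivability is differentiability and the chain rule
    holds. *)
Lemma derive_comp f (q : R -> R) x (v : 'rV[R]_d) :
  derivable f x v -> derivable q (f x) 1 ->
  derivable (q \o f) x v /\ 'D_v (q \o f) x = 'D_1 q (f x) * 'D_v f x.
Proof.
move=> df dq; pose p := fun h : R => h *: v + x.
have p0 : p 0 = x by rewrite /p scale0r add0r.
have pE h : p (h *: (1 : R) + 0) = h *: v + p 0 by rewrite p0 /p addr0 [h *: 1]mulr1.
have dfp : derivable (f \o p) 0 1 by apply/(derivable_affine f pE); rewrite p0.
have dq0 : derivable q ((f \o p) 0) 1 by rewrite /= p0.
have e1 : 'D_1 ((q \o f) \o p) 0 = 'D_v (q \o f) (p 0) := derive_affine _ pE.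
have e2 : 'D_1 (f \o p) 0 = 'D_v f (p 0) := derive_affine f pE.
rewrite p0 in e1 e2; split.
  have h1 := (derivable1_diffP _ _).1 dfp; have h2 := (derivable1_diffP _ _).1 dq0.
  have h : derivable (q \o (f \o p)) 0 1.
    exact: (derivable1_diffP _ _).2 (differentiable_comp h1 h2).
  by rewrite -p0; exact: ((derivable_affine (q \o f) pE).1 h).
have dc := derive1_comp dfp dq0; rewrite !derive1E in dc.
rewrite -e1 -e2; have -> : f x = (f \o p) 0 by rewrite /= p0.
exact: dc.
Qed.

Lemma C1_cst (c : R) : C1 (fun _ : 'rV[R]_d => c).
Proof.
split=> [|i]; first exact: cst_continuous.
split => [x|]; first exact: derivable_cst.
rewrite (_ : partial i _ = cst 0); first exact: cst_continuous.
by apply/funext => x; exact: derive_cst.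
Qed.

Lemma C1_coord j : C1 (fun x : 'rV[R]_d => x ord0 j).
Proof.
split=> [|i]; first exact: coord_continuous.
split => [x|]; first by have [] := is_derive_coord x i j.
rewrite (_ : partial i _ = cst (i == j)%:R); first exact: cst_continuous.
by apply/funext => x; have [] := is_derive_coord x i j.
Qed.

Lemma partialD f g i x : C1 f -> C1 g ->
  partial i (fun x => f x + g x) x = partial i f x + partial i g x.
Proof. by move=> [_ /(_ i)[df _]] [_ /(_ i)[dg _]]; exact: deriveD. Qed.

Lemma partialM f g i x : C1 f -> C1 g ->
  partial i (fun x => f x * g x) x = f x * partial i g x + g x * partial i f x.
Proof. by move=> [_ /(_ i)[df _]] [_ /(_ i)[dg _]]; exact: deriveM. Qed.

Lemma C1D f g : C1 f -> C1 g -> C1 (fun x => f x + g x).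
Proof.
move=> Cf Cg; split => [|i]; first exact: contD Cf.1 Cg.1.
split => [x|]; first by apply: derivableD; [exact: (Cf.2 i).1|exact: (Cg.2 i).1].
rewrite (_ : partial i _ = fun x => partial i f x + partial i g x).
  exact: contD (Cf.2 i).2 (Cg.2 i).2.
by apply/funext => x; exact: partialD.
Qed.

Lemma C1M f g : C1 f -> C1 g -> C1 (fun x => f x * g x).
Proof.
move=> Cf Cg; split => [|i]; first exact: contM Cf.1 Cg.1.
split => [x|]; first by apply: derivableM; [exact: (Cf.2 i).1|exact: (Cg.2 i).1].
rewrite (_ : partial i _ = fun x => f x * partial i g x + g x * partial i f x).
  apply: contD; apply: contM;
    [exact: Cf.1|exact: (Cg.2 i).2|exact: Cg.1|exact: (Cf.2 i).2].
by apply/funext => x; exact: partialM.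
Qed.

Lemma C1_sum (I : Type) (r : seq I) (F : I -> 'rV[R]_d -> R) :
  (forall k, C1 (F k)) -> C1 (fun x => \sum_(k <- r) F k x) /\
  forall i x, partial i (fun x => \sum_(k <- r) F k x) x = \sum_(k <- r) partial i (F k) x.
Proof.
move=> CF; elim: r => [|k r [IH IHd]].
  under eq_fun do rewrite big_nil; split => [|i x]; first exact: C1_cst.
  by rewrite big_nil; exact: derive_cst.
under eq_fun do rewrite big_cons; split => [|i x]; first exact: C1D.
by rewrite big_cons partialD// IHd.
Qed.

Lemma C1_comp f (q q' : R -> R) : C1 f -> (forall t : R, is_derive t 1 q (q' t)) ->
  continuous q' ->
  C1 (q \o f) /\ forall i x, partial i (q \o f) x = q' (f x) * partial i f x.
Proof.
move=> Cf dq cq.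
have dE i x : partial i (q \o f) x = q' (f x) * partial i f x.
  have [dq1 dq2] := dq (f x).
  have [_] := derive_comp ((Cf.2 i).1 x) dq1.
  by rewrite dq2.
split=> //; split => [x|i].
  apply: continuous_comp; first exact: Cf.1.
  by apply: differentiable_continuous; apply/derivable1_diffP; have [] := dq (f x).
split => [x|].
  by have [dq1 _] := dq (f x); exact: (derive_comp ((Cf.2 i).1 x) dq1).1.
rewrite (_ : partial i _ = fun x => q' (f x) * partial i f x); last exact/funext.
apply: contM; last exact: (Cf.2 i).2.
by move=> x; apply: continuous_comp; [exact: Cf.1|exact: cq].
Qed.

Lemma C1V f : C1 f -> (forall x, f x != 0) -> C1 (fun x => (f x)^-1) /\
  forall i x, partial i (fun x => (f x)^-1) x = - (f x) ^- 2 * partial i f x.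
Proof.
move=> Cf f0.
have dE i x : partial i (fun x => (f x)^-1) x = - (f x) ^- 2 * partial i f x.
  exact: (deriveV (f0 x) ((Cf.2 i).1 x)).
split=> //; split => [|i]; first exact: contV Cf.1 f0.
split => [x|]; first by apply: derivableV; [exact: f0|exact: (Cf.2 i).1].
rewrite (_ : partial i _ = fun x => - (f x) ^- 2 * partial i f x); last exact/funext.
apply: contM; last exact: (Cf.2 i).2.
apply: contN; apply: contV; last by move=> x; rewrite expf_neq0.
exact: (contM Cf.1 Cf.1).
Qed.

(** The distance is not differentiable at [a]; its square is [C1] everywhere and has the balls as
    sublevel sets. *)
Definition sqdist a x := \sum_i (x ord0 i - a ord0 i) ^+ 2.

Lemma sqdistE a x : sqdist a x = enorm (x - a) ^+ 2.
Proof. by rewrite enormE; apply: eq_bigr => i _; rewrite !mxE. Qed.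

Lemma sqdist_ge0 a x : 0 <= sqdist a x.
Proof. by rewrite sqdistE sqr_ge0. Qed.

Lemma C1_sqdist a : C1 (sqdist a) /\
  forall i x, partial i (sqdist a) x = 2 * (x ord0 i - a ord0 i).
Proof.
have Ck k : C1 (fun x : 'rV[R]_d => x ord0 k - a ord0 k) by apply: C1D; [exact: C1_coord|exact: C1_cst].
have [C D] := @C1_sum _ (index_enum 'I_d) (fun k x => (x ord0 k - a ord0 k) * (x ord0 k - a ord0 k)) (fun k => C1M (Ck k) (Ck k)).
split; first exact: C.
move=> i x; rewrite [LHS]D.
have E k : partial i (fun x : 'rV[R]_d => x ord0 k - a ord0 k) x = (i == k)%:R.
  rewrite partialD; [|exact: C1_coord|exact: C1_cst].
  by rewrite /partial derive_cst addr0; have [] := is_derive_coord x i k.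
rewrite (bigD1 i)//= big1 ?addr0; last first.
  by move=> k ki; rewrite partialM// E eq_sym (negbTE ki) mulr0 addr0.
by rewrite partialM// E eqxx mulr1; ring.
Qed.

Lemma eballE a x (s : R) : 0 <= s -> eball a s x <-> sqdist a x < s ^+ 2.
Proof. by move=> s0; rewrite /eball /= sqdistE ltr_pXn2r// nnegrE ?enorm_ge0. Qed.

Lemma open_eball a (s : R) : open (eball a s).
Proof.
have [s0|s0] := leP 0 s; last first.
  rewrite (_ : eball a s = set0); first exact: open0.
  by apply/seteqP; split => // x /= xs; have := lt_trans (le_lt_trans (enorm_ge0 _) xs) s0; rewrite ltxx.
rewrite (_ : eball a s = [set x | sqdist a x < s ^+ 2]).
  by apply: (@open_comp _ _ (sqdist a) [set z | z < s ^+ 2]) => [x _|];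
    [exact: (C1_sqdist a).1.1|exact: open_lt].
by apply/funext => x; apply/propext; exact: eballE.
Qed.

Lemma closed_sqdist_le a (s : R) : closed [set x | sqdist a x <= s].
Proof.
apply: (@closed_comp _ _ (sqdist a) [set z | z <= s]) => [x _|]; last exact: closed_le.
exact: (C1_sqdist a).1.1.
Qed.
End C1_theory.

(** * Hardy's inequality *)

Section hardy.
Context {R : realType} {d : nat}.
Implicit Types (f g : 'rV[R]_d -> R) (x y a : 'rV[R]_d) (i j : 'I_d).

Lemma integrable_sumR (I : Type) (r : seq I) (F : I -> 'rV[R]_d -> R) :
  (forall k, (lebesgue_rV d).-integrable setT (fun x : borel R d => (F k x)%:E)) ->
  (lebesgue_rV d).-integrable setT (fun x : borel R d => (\sum_(k <- r) F k x)%:E).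
Proof.
move=> iF; under eq_fun do rewrite -sumEFin.
exact: integrable_sum.
Qed.

Lemma boxedM M f g : boxed M f -> boxed M (fun x => f x * g x).
Proof. by move=> bf x i xi; rewrite (bf x i xi) mul0r. Qed.

Lemma enorm_gradE f x : enorm (grad f x) ^+ 2 = \sum_i partial i f x ^+ 2.
Proof. by rewrite enormE; apply: eq_bigr => i _; rewrite mxE. Qed.

Lemma continuous_grad_sqr f : C1 f -> continuous (fun x => enorm (grad f x) ^+ 2).
Proof.
move=> [_ Cf]; under eq_fun do rewrite enorm_gradE.
have Cs (r : seq 'I_d) : continuous (fun x => \sum_(i <- r) partial i f x ^+ 2).
  elim: r => [|i r IH].
    by under eq_fun do rewrite big_nil; exact: cst_continuous.
  under eq_fun do rewrite big_cons; apply: contD => //.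
  exact: (contM (Cf i).2 (Cf i).2).
exact: Cs.
Qed.

Lemma grad_boxed f M : boxed M f -> boxed M (fun x => enorm (grad f x) ^+ 2).
Proof.
move=> bf x i xi; rewrite enorm_gradE big1// => j _.
by rewrite (boxed_partial j bf xi) expr0n.
Qed.

(* The divergence of [f^2 (x - a) / (|x - a|^2 + s^2)] integrates to 0; in
   dimension at least 3 it dominates [f^2 / (2 (|x - a|^2 + s^2)) - 2 |grad f|^2]. *)
Lemma hardy M f a (s : R) : (2 < d)%N -> 0 < s -> C1 f -> boxed M f ->
  (\int[lebesgue_rV d]_x ((f x ^+ 2 / (sqdist a x + s ^+ 2))%:E) <=
   4%:E * \int[lebesgue_rV d]_x (enorm (grad f x) ^+ 2)%:E)%E.
Proof.
move=> d2 s0 Cf bf.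
have [Cq Dq] := C1_sqdist a.
pose q x := sqdist a x + s ^+ 2.
have q0 x : 0 < q x by rewrite ltr_wpDl ?sqdist_ge0 ?exprn_gt0.
have qn0 x : q x != 0 by rewrite gt_eqF.
have Cqs : C1 q by exact: (C1D Cq (C1_cst _)).
have Dqs i x : partial i q x = 2 * (x ord0 i - a ord0 i).
  by rewrite /q (partialD _ _ Cq (C1_cst _)) Dq /partial derive_cst addr0.
have [Cw Dw] := C1V Cqs qn0.
pose w x := (q x)^-1.
have Cy i : C1 (fun x : 'rV[R]_d => x ord0 i - a ord0 i).
  by apply: C1D; [exact: C1_coord|exact: C1_cst].
have Dy i x : partial i (fun x : 'rV[R]_d => x ord0 i - a ord0 i) x = 1.
  rewrite partialD; [|exact: C1_coord|exact: C1_cst].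
  by rewrite /partial derive_cst addr0; have [_ ->] := is_derive_coord x i i; rewrite eqxx.
have Cff : C1 (fun x => f x * f x) by exact: C1M.
pose H i x := f x * f x * ((x ord0 i - a ord0 i) * w x).
have CH i : C1 (H i) by exact: (C1M Cff (C1M (Cy i) Cw)).
have bH i : boxed M (H i) by do 2 apply: boxedM.
have DH i x : partial i (H i) x = 2 * f x * w x * (x ord0 i - a ord0 i) * partial i f x
    + f x ^+ 2 * w x - 2 * f x ^+ 2 * w x ^+ 2 * (x ord0 i - a ord0 i) ^+ 2.
  rewrite /H (partialM _ _ Cff (C1M (Cy i) Cw)).
  rewrite (partialM _ _ (Cy i) Cw) (partialM _ _ Cf Cf) Dy Dw Dqs.
  have -> : q x ^- 2 = w x ^+ 2 by rewrite exprVn.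
  rewrite /w; ring.
have key x : 2^-1 * (f x ^+ 2 * w x) <= \sum_i partial i (H i) x + 2 * enorm (grad f x) ^+ 2.
  pose S := f x ^+ 2 * w x.
  have w0 : 0 < w x by rewrite invr_gt0.
  have S0 : 0 <= S by rewrite mulr_ge0 ?sqr_ge0 ?ltW.
  have qw : sqdist a x * w x <= 1.
    by rewrite ler_pdivrMr// mul1r lerDl sqr_ge0.
  have qw0 : 0 <= sqdist a x * w x by rewrite mulr_ge0 ?sqdist_ge0 ?ltW.
  (* Completing the square bounds the mixed term below by [- (f w y)^2 / 2 - 2 p^2], with [y] the
     coordinate and [p] the partial derivative. Summed over [i], at least [3 S] is gained and at
     most [5/2 S] lost, which leaves the [S / 2] of [key]. *)
  have lb i : S - 5 / 2 * (S * (w x * (x ord0 i - a ord0 i) ^+ 2)) - 2 * partial i f x ^+ 2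
      <= partial i (H i) x.
    rewrite DH /S -subr_ge0.
    set y := x ord0 i - a ord0 i; set p := partial i f x; set W := w x; set F := f x.
    have -> : 2 * F * W * y * p + F ^+ 2 * W - 2 * F ^+ 2 * W ^+ 2 * y ^+ 2 -
      (F ^+ 2 * W - 5 / 2 * (F ^+ 2 * W * (W * y ^+ 2)) - 2 * p ^+ 2) =
      2^-1 * (F * W * y + 2 * p) ^+ 2 by field.
    by rewrite mulr_ge0 ?sqr_ge0 ?invr_ge0.
  have : \sum_i (S - 5 / 2 * (S * (w x * (x ord0 i - a ord0 i) ^+ 2)) - 2 * partial i f x ^+ 2)
     <= \sum_i partial i (H i) x by apply: ler_sum => i _; exact: lb.
  rewrite !sumrB sumr_const card_ord -!mulr_sumr -enorm_gradE -/(sqdist a x) => h.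
  have d3 : 3 * S <= S *+ d by rewrite -(mulr_natl S d) ler_wpM2r// ler_nat.
  have Sq : S * (w x * sqdist a x) <= S by rewrite ler_piMr// mulrC.
  rewrite -/S; lra.
have iH i := C1_integrable_partial i (CH i) (bH i).
have iG : (lebesgue_rV d).-integrable setT (fun x : borel R d => (enorm (grad f x) ^+ 2)%:E).
  by apply: (@boxed_integrable _ _ M); [exact: continuous_grad_sqr|exact: grad_boxed].
have ifw : (lebesgue_rV d).-integrable setT (fun x : borel R d => (f x ^+ 2 * w x)%:E).
  by apply: (@boxed_integrable _ _ M); [exact: (contM Cff.1 Cw.1)|do 2 apply: boxedM].
have : (\int[lebesgue_rV d]_x (2^-1%:E * (f x ^+ 2 * w x)%:E) <=
   \int[lebesgue_rV d]_x ((\sum_i partial i (H i) x)%:E + 2%:E * (enorm (grad f x) ^+ 2)%:E))%E.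
  apply: le_integral => //; first exact: integrableZl.
    apply: integrableD => //; last exact: integrableZl.
    exact: integrable_sumR.
  by move=> x _; rewrite -!EFinM -EFinD lee_fin; exact: key.
rewrite integralZl// integralD//; [|exact: integrable_sumR|exact: integrableZl].
under [X in (_ <= X + _)%E]eq_integral do rewrite -sumEFin.
rewrite integral_sum// big1 ?add0e; last first.
  by move=> i _; exact: integral_partial (CH i) (bH i).
rewrite integralZl//.
have /fineK <- := integrable_fin_num measurableT ifw.
have /fineK <- := integrable_fin_num measurableT iG.
rewrite -!EFinM !lee_fin; lra.
Qed.

(** Regularising at the scale [s] of the ball makes the Hardy weight at least [1 / (2 s^2)] there;
    with the constant 4 this gives 8. It acts as a Poincare inequality without any condition on the
    sphere: [f] has only to vanish far away. *)
Lemma hardy_ball M f a (s : R) : (2 < d)%N -> 0 < s -> C1 f -> boxed M f ->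
  (\int[lebesgue_rV d]_(x in eball a s) (f x ^+ 2)%:E <=
   (8 * s ^+ 2)%:E * \int[lebesgue_rV d]_x (enorm (grad f x) ^+ 2)%:E)%E.
Proof.
move=> d2 s0 Cf bf.
have [Cq _] := C1_sqdist a.
have mb := measurable_open (@open_eball R d a s).
pose q x := sqdist a x + s ^+ 2.
have q0 x : 0 < q x by rewrite ltr_wpDl ?sqdist_ge0 ?exprn_gt0.
have cfw : continuous (fun x => f x ^+ 2 / q x).
  apply: contM; first exact: (contM Cf.1 Cf.1).
  apply: contV => [|x]; last by rewrite gt_eqF.
  by apply: contD; [exact: Cq.1|exact: cst_continuous].
have mfw := measurable_continuous cfw.
have mf2 := measurable_continuous (contM Cf.1 Cf.1).
have fw0 x : 0 <= f x ^+ 2 / q x by rewrite divr_ge0 ?sqr_ge0 ?ltW.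
apply: (@le_trans _ _ ((2 * s ^+ 2)%:E * \int[lebesgue_rV d]_x ((f x ^+ 2 / q x)%:E))%E); last first.
  rewrite (_ : 8 * s ^+ 2 = (2 * s ^+ 2) * 4); last by ring.
  rewrite (EFinM (2 * s ^+ 2)) -muleA; apply: lee_wpmul2l.
    by rewrite lee_fin mulr_ge0 ?sqr_ge0.
  exact: (hardy a d2 s0 Cf bf).
rewrite -ge0_integralZl//; [|exact/measurable_EFinP|by move=> x _; rewrite lee_fin|by rewrite lee_fin mulr_ge0 ?sqr_ge0].
apply: (@le_trans _ _ (\int[lebesgue_rV d]_(x in eball a s) ((2 * s ^+ 2)%:E * (f x ^+ 2 / q x)%:E))%E).
  apply: ge0_le_integral => //.
  - by move=> x _; rewrite lee_fin sqr_ge0.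
  - by apply/measurable_EFinP; exact: measurable_funTS.
  - apply/measurable_EFinP/measurable_funTS; exact: measurable_funM.
  - move=> x xs; rewrite -EFinM lee_fin mulrA ler_pdivlMr// mulrC ler_wpM2r ?sqr_ge0//.
    rewrite /q sqdistE; have : enorm (x - a) ^+ 2 <= s ^+ 2.
      by rewrite ler_pXn2r ?nnegrE ?enorm_ge0 ?(ltW s0)// ltW.
    lra.
apply: ge0_subset_integral => //.
- apply/measurable_EFinP; exact: measurable_funM.
- by move=> x _; rewrite -EFinM lee_fin mulr_ge0// mulr_ge0 ?sqr_ge0.
Qed.
End hardy.

(** * Smooth functions *)

Section flat.
Context {R : realType}.
Implicit Types (p : {poly R}) (t : R).

(** The family [p(1/t) exp(-1/t)], extended by 0, is closed under differentiation, [p] becoming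
    [X^2 (p - p')]. All derivatives of [exp(-1/t)] are thereby treated at once. *)
Definition flat p t : R := if 0 < t then p.[t^-1] * expR (- t^-1) else 0.

Lemma horner_le_expR p : exists2 c : R, 0 <= c & forall t, 0 <= t -> `|p.[t]| <= c * expR t.
Proof.
exists (\sum_(i < size p) `|p`_i| * (i`!)%:R).
  by apply: sumr_ge0 => i _; rewrite mulr_ge0.
move=> t t0; rewrite horner_coef; apply: le_trans (ler_norm_sum _ _ _) _.
rewrite mulr_suml; apply: ler_sum => i _.
rewrite normrM -mulrA ler_wpM2l// ger0_norm ?exprn_ge0//.
case: (nat_of_ord i) => [|k]; first by rewrite expr0 fact0 mul1r (le_trans _ (expR_ge1Dx t))// lerDl.
have := expR_ge1Dxn k t0.
have f0 : 0 < (k.+1`!)%:R :> R by rewrite ltr0n fact_gt0.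
move=> h; rewrite mulrC -ler_pdivrMr//; apply: le_trans h.
by rewrite lerDr.
Qed.

Lemma flat_le p : exists2 c : R, 0 <= c & forall t, `|flat p t| <= c * `|t|.
Proof.
have [c c0 pc] := horner_le_expR (p * 'X).
exists c => // t; rewrite /flat; case: ifPn => [t0|_]; last by rewrite normr0 mulr_ge0.
have ti0 : 0 < t^-1 by rewrite invr_gt0.
have := pc _ (ltW ti0); rewrite hornerM hornerX normrM (gtr0_norm ti0).
rewrite ler_pdivrMr// => h.
rewrite normrM (gtr0_norm (expR_gt0 _)) (gtr0_norm t0) expRN ler_pdivrMr ?expR_gt0//.
by rewrite mulrAC.
Qed.

Lemma flat_gt0E p t : 0 < t -> flat p t = p.[t^-1] * expR (- t^-1).
Proof. by rewrite /flat => ->. Qed.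

Lemma flat_le0E p t : t <= 0 -> flat p t = 0.
Proof. by rewrite /flat ltNge => ->. Qed.

Lemma is_derive_flat p t : is_derive t 1 (flat p) (flat ('X^2 * (p - p^`())) t).
Proof.
have [t0|t0|->] := ltgtP t 0.
- rewrite (flat_le0E _ (ltW t0)).
  have := is_derive_cst (0 : R) t (1 : R); apply: near_eq_is_derive.
  near=> s; rewrite flat_le0E//; apply: ltW; near: s; exact: lt_nbhsl.
- apply: (@near_eq_is_derive _ _ _ (fun s : R => p.[s^-1] * expR (- s^-1))).
    near=> s; rewrite flat_gt0E//; near: s; exact: lt_nbhsr.
  rewrite flat_gt0E//.
  have tn0 : t != 0 by rewrite gt_eqF.
  have dV : is_derive t 1 (fun s : R => s^-1) (- t ^- 2).
    have h := @is_deriveV R id t 1 1 tn0 (is_derive_id t 1).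
    by apply: is_derive_eq h _; rewrite [_ *: _]mulr1.
  have dp : is_derive t 1 (horner p \o (fun s : R => s^-1)) (p^`().[t^-1] * - t ^- 2).
    have hp : is_derive t^-1 1 (horner p) p^`().[t^-1].
      by apply: DeriveDef; [exact: derivable_horner|rewrite -derive1E derivE].
    exact: is_derive1_comp.
  have dN : is_derive t 1 (fun s : R => - s^-1) (t ^- 2).
    by have h := is_deriveN dV; apply: is_derive_eq h _; rewrite opprK.
  have dE : is_derive t 1 (expR \o (fun s : R => - s^-1)) (expR (- t^-1) * t ^- 2).
    exact: is_derive1_comp.
  have h := is_deriveM dp dE; apply: is_derive_eq h _.
  rewrite hornerM hornerXn hornerD hornerN exprVn /GRing.scale /=; ring.
- rewrite (flat_le0E _ (lexx _)).
  (* The difference quotient of [flat p] at 0 is [flat ('X * p)], which the linear bound of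
     [flat_le] sends to 0. *)
  have [c c0 pc] := flat_le ('X * p).
  have cv : (fun h : R => h^-1 *: ((flat p \o shift 0) (h *: 1) - flat p 0)) @ 0^' --> (0 : R).
    apply/cvgr0Pnorm_lt => e e0; near=> h.
    have h0 : h != 0 by near: h; exact: nbhs_dnbhs_neq.
    rewrite /= addr0 (flat_le0E _ (lexx _)) subr0 [h *: 1]mulr1.
    have -> : h^-1 *: flat p h = flat ('X * p) h.
      rewrite /flat; case: ifPn => [hp|_]; last by rewrite scaler0.
      by rewrite hornerM hornerX -mulrA.
    apply: le_lt_trans (pc h) _.
    apply: (@le_lt_trans _ _ ((c + 1) * `|h|)); first by rewrite ler_wpM2r// lerDl.
    rewrite mulrC -ltr_pdivlMr ?ltr_wpDl//; near: h.
    by apply: dnbhs0_lt; rewrite divr_gt0// ltr_wpDl.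
  by apply: DeriveDef; [apply/cvg_ex; exists 0; exact: cv|exact/cvg_lim/cv].
Unshelve. all: end_near. Qed.

Lemma continuous_flat p : continuous (flat p).
Proof.
move=> t; apply: differentiable_continuous; apply/derivable1_diffP.
by have [] := is_derive_flat p t.
Qed.

Definition bump t : R := flat 1 t.

Lemma bump_ge0 t : 0 <= bump t.
Proof. by rewrite /bump /flat; case: ifP => // _; rewrite hornerC mul1r expR_ge0. Qed.

Lemma bump_gt0 t : (0 < bump t) = (0 < t).
Proof.
by rewrite /bump /flat; case: ifP => // _; rewrite ?ltxx// hornerC mul1r expR_gt0.
Qed.

Lemma bump_le1 t : bump t <= 1.
Proof.
rewrite /bump /flat; case: ifP => // t0; rewrite hornerC mul1r -expR0 ler_expR.
by rewrite oppr_le0 invr_ge0 ltW.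
Qed.

Lemma bump_le s t : s <= t -> bump s <= bump t.
Proof.
move=> st; have [s0|s0] := ltP 0 s; last by rewrite /bump (flat_le0E _ s0) bump_ge0.
rewrite /bump !flat_gt0E ?(lt_le_trans s0 st)// !hornerC !mul1r ler_expR lerN2.
by rewrite lef_pV2 ?posrE ?(lt_le_trans s0 st).
Qed.
End flat.

Section smooth.
Context {R : realType} {d : nat}.
Implicit Types (f g : 'rV[R]_d -> R).

(** A class of expressions stable under partial derivatives. Since [smooth] quantifies over all
    iterated partials, it is enough that every member is [C1] with partials in the class; no Leibniz
    or chain rule of higher order is needed. *)
Inductive elementary : ('rV[R]_d -> R) -> Prop :=
| elementary_cst c : elementary (fun=> c)
| elementary_coord i : elementary (fun x => x ord0 i)
| elementaryD f g : elementary f -> elementary g -> elementary (fun x => f x + g x)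
| elementaryM f g : elementary f -> elementary g -> elementary (fun x => f x * g x)
| elementary_flat p f : elementary f -> elementary (fun x => flat p (f x)).

Lemma elementary_C1 f : elementary f -> C1 f /\ forall i, elementary (partial i f).
Proof.
elim=> {f} [c|j|f g _ [Cf Ef] _ [Cg Eg]|f g ef [Cf Ef] eg [Cg Eg]|p f ef [Cf Ef]].
- split=> [|i]; first exact: C1_cst.
  rewrite (_ : partial i _ = fun=> 0); first exact: elementary_cst.
  by apply/funext => x; exact: derive_cst.
- split=> [|i]; first exact: C1_coord.
  rewrite (_ : partial i _ = fun=> (i == j)%:R); first exact: elementary_cst.
  by apply/funext => x; have [] := is_derive_coord x i j.
- split=> [|i]; first exact: (C1D Cf Cg).
  rewrite (_ : partial i _ = fun x => partial i f x + partial i g x).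
    exact: elementaryD (Ef i) (Eg i).
  by apply/funext => x; exact: (partialD _ _ Cf Cg).
- split=> [|i]; first exact: (C1M Cf Cg).
  rewrite (_ : partial i _ = fun x => f x * partial i g x + g x * partial i f x).
    exact: elementaryD (elementaryM ef (Eg i)) (elementaryM eg (Ef i)).
  by apply/funext => x; exact: (partialM _ _ Cf Cg).
- have [C D] := C1_comp Cf (is_derive_flat p) (continuous_flat (p := _)).
  split=> [|i]; first exact: C.
  rewrite (_ : partial i _ = fun x => flat ('X^2 * (p - p^`())) (f x) * partial i f x).
    exact: elementaryM (elementary_flat _ ef) (Ef i).
  by apply/funext => x; exact: D.
Qed.

Lemma elementary_smooth f : elementary f -> smooth f.
Proof.
move=> ef s.
have es : elementary (foldr partial f s).
  by elim: s => //= i s IH; exact: (elementary_C1 IH).2.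
have [[cf df] _] := elementary_C1 es.
by split=> // i x; exact: (df i).1.
Qed.

Lemma elementary_sum (I : Type) (r : seq I) (F : I -> 'rV[R]_d -> R) :
  (forall i, elementary (F i)) -> elementary (fun x => \sum_(i <- r) F i x).
Proof.
move=> eF; elim: r => [|i r IH].
  by under eq_fun do rewrite big_nil; exact: elementary_cst.
by under eq_fun do rewrite big_cons; exact: elementaryD.
Qed.

Lemma elementary_prod (I : Type) (r : seq I) (F : I -> 'rV[R]_d -> R) :
  (forall i, elementary (F i)) -> elementary (fun x => \prod_(i <- r) F i x).
Proof.
move=> eF; elim: r => [|i r IH].
  by under eq_fun do rewrite big_nil; exact: elementary_cst.
by under eq_fun do rewrite big_cons; exact: elementaryM.
Qed.
End smooth.

(** * Test functions and the capacity of balls *)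

Section test_functions.
Context {R : realType} {d : nat}.
Implicit Types (f g phi : 'rV[R]_d -> R) (x y a : 'rV[R]_d) (D : set 'rV[R]_d).

Lemma coord_le_norm x i : `|x ord0 i| <= `|x|.
Proof.
rewrite [leRHS]/Num.norm /= mx_normrE.
exact: (le_bigmax _ (fun ij => `|x ij.1 ij.2|) (ord0, i)).
Qed.

Lemma smooth_C1 f : smooth f -> C1 f.
Proof.
move=> sf; split=> [|i]; first by have [] := sf [::].
split=> [x|]; first by have [_] := sf [::]; exact.
by have [] := sf [:: i].
Qed.

Lemma compact_boxed f : compact (supp f) -> exists M, boxed M f.
Proof.
move=> /compact_bounded[M [_ HM]]; exists (`|M| + 1) => x i xi.
apply: contrapT => /eqP fx0.
have : `|x| <= `|M| + 1.
  apply: HM; first by rewrite (le_lt_trans (ler_norm M))// ltrDl.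
  exact: subset_closure.
by move=> /(le_trans (coord_le_norm x i)); rewrite leNgt xi.
Qed.

Lemma notin_supp f x : ~ supp f x -> f x = 0.
Proof.
move=> nx; apply: contrapT => /eqP fx; apply: nx; exact: subset_closure.
Qed.

Lemma partial_notin_supp f x i : ~ supp f x -> partial i f x = 0.
Proof.
move=> nx; rewrite /partial (@near_eq_derive _ _ _ f (cst 0)) ?derive_cst//.
have oA : open (~` supp f) by exact/closed_openC/closed_closure.
near=> y; apply: notin_supp; near: y; exact: (open_nbhs_nbhs (conj oA nx)).
Unshelve. all: end_near. Qed.

Lemma test_C1 D phi : test_function D phi -> C1 phi.
Proof. by move=> [sp _ _]; exact: smooth_C1. Qed.

Lemma test_boxed D phi : test_function D phi -> exists M, boxed M phi.
Proof. by move=> [_ cp _]; exact: compact_boxed. Qed.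

Lemma test_out D phi x : test_function D phi -> ~ D x ->
  phi x = 0 /\ forall i, partial i phi x = 0.
Proof.
move=> [_ _ sD] nD; have ns : ~ supp phi x by move=> /sD.
by split=> [|i]; [exact: notin_supp|exact: partial_notin_supp].
Qed.

Definition cbox a (s : R) : set 'rV[R]_d :=
  [set x | forall i, `[a ord0 i - s, a ord0 i + s]%classic (x ord0 i)].

Lemma compact_cbox a s : compact (cbox a s).
Proof.
exact: (@rV_compact _ _ (fun i => `[a ord0 i - s, a ord0 i + s]%classic) (fun=> @segment_compact _ _ _)).
Qed.

Lemma measurable_cbox a s : measurable (cbox a s : set (borel R d)).
Proof. by apply: measurable_closed; apply: compact_closed; [exact: norm_hausdorff|exact: compact_cbox]. Qed.

Lemma lebesgue_cbox a s : 0 <= s -> lebesgue_rV d (cbox a s) = ((2 * s) ^+ d)%:E.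
Proof.
move=> s0; pose B i : set R := `[a ord0 i - s, a ord0 i + s]%classic.
rewrite (@lebesgue_rV_box R d B); last by move=> i; exact: measurable_itv.
have mB i : lebesgue_measure (B i) = (2 * s)%:E.
  rewrite /B lebesgue_measure_itv /= lte_fin; case: ltP => [_|].
    by rewrite -EFinB; congr EFin; ring.
  move=> h; have -> : s = 0 by lra.
  by rewrite mulr0.
under eq_bigr do rewrite mB.
by rewrite prodEFin prodr_const card_ord.
Qed.

Lemma cboxP a s x : cbox a s x <-> forall i, `|x ord0 i - a ord0 i| <= s.
Proof. by split=> h i; have := h i; rewrite /= in_itv /= ler_distl. Qed.

Lemma eball_sub_cbox a s : eball a s `<=` cbox a s.
Proof.
move=> x xs; apply/cboxP => i; have := coord_le_enorm (x - a) i; rewrite !mxE.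
by move=> /le_trans; apply; exact: ltW.
Qed.

Lemma elementary_sqdist a (r : R) (k : R) : elementary (fun x => k + r * sqdist a x).
Proof.
apply: elementaryD; first exact: elementary_cst.
apply: elementaryM; first exact: elementary_cst.
apply: elementary_sum => i; under eq_fun do rewrite expr2.
by apply: elementaryM; apply: elementaryD; (exact: elementary_coord || exact: elementary_cst).
Qed.

Lemma closure_eball_le a (r : R) x : 0 <= r -> closure (eball a r) x -> sqdist a x <= r ^+ 2.
Proof.
move=> r0; have cl := @closed_sqdist_le R d a (r ^+ 2).
rewrite closureE /= => /(_ [set x | sqdist a x <= r ^+ 2]) /=; apply; split => // y.
by move=> /(eballE _ _ r0)/ltW.
Qed.

(** Explicit test function: a multiple of [exp(-1/t)] at [t = 9/4 - |x - a|^2 / r^2]. The value 9/4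
    places the support in the ball of radius [3r/2], and the normalising [b] is the value on the
    sphere of radius [r], where [t = 5/4]. *)
Lemma capacity_eball_le : exists2 c : R, 0 < c & forall a (r : R), 0 < r ->
  (capacity (closure (eball a r)) (eball a (2 * r)) <= (c * r ^+ d / r ^+ 2)%:E)%E.
Proof.
pose b := bump (5 / 4 : R).
have b0 : 0 < b by rewrite bump_gt0.
have [C C0 HC] := @flat_le R ('X^2 * (1 - 1^`())).
(* [C * (9 / 4)] bounds the derivative of [bump] on the range of [f], [16 / r^2] bounds the squared
   gradient of [f] on [B(a,2r)], and [(4 r)^d] is the volume of a box around that ball. [C] may be
   0, hence [c + 1] as the positive witness. *)
pose c := (C * (9 / 4) / b) ^+ 2 * 16 * 4 ^+ d.
have c0 : 0 <= c by apply: mulr_ge0; [apply: mulr_ge0 => //; exact: sqr_ge0|exact: exprn_ge0].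
exists (c + 1); first by rewrite ltr_wpDl.
move=> a r r0; pose k := - (r ^+ 2)^-1.
pose f x := 9 / 4 + k * sqdist a x.
pose v x := b^-1 * bump (f x).
have r20 : 0 < r ^+ 2 by rewrite exprn_gt0.
have ef : elementary f by exact: elementary_sqdist.
have ev : elementary v.
  by apply: elementaryM; [exact: elementary_cst|exact: elementary_flat].
have v0 x : v x != 0 -> sqdist a x <= (9 / 4) * r ^+ 2.
  apply: contraNle => h; rewrite /v /bump flat_le0E ?mulr0// /f /k mulNr subr_le0.
  by rewrite [leRHS]mulrC ler_pdivlMr// ltW.
have sv : supp v `<=` [set x | sqdist a x <= (9 / 4) * r ^+ 2].
  rewrite /supp closureE => x; apply; split => //; exact: closed_sqdist_le.
have sb : [set x | sqdist a x <= (9 / 4) * r ^+ 2] `<=` eball a (2 * r).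
  move=> x /= h; apply/eballE; first by rewrite mulr_ge0 ?ltW.
  by apply: le_lt_trans h _; rewrite exprMn ltr_pM2r//; lra.
have tv : test_function (eball a (2 * r)) v.
  split; first exact: elementary_smooth.
    apply: (@subclosed_compact _ _ (cbox a (2 * r)));
      [exact: closed_closure|exact: compact_cbox|].
    by apply: subset_trans sv _; apply: subset_trans sb _; exact: eball_sub_cbox.
  exact: subset_trans sv sb.
have v1 x : closure (eball a r) x -> 1 <= v x.
  move=> /(closure_eball_le (ltW r0)) h.
  rewrite /v [leRHS]mulrC ler_pdivlMr// mul1r; apply: bump_le.
  have : k * r ^+ 2 = -1 by rewrite /k mulNr mulVf ?gt_eqF.
  have : k * r ^+ 2 <= k * sqdist a x by rewrite ler_wnM2l// oppr_le0 invr_ge0 ltW.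
  rewrite /f; lra.
apply: ereal_inf_le; exists (\int[lebesgue_rV d]_(x in eball a (2 * r)) (enorm (grad v x) ^+ 2)%:E)%E.
  by exists v.
have [Cq Dq] := @C1_sqdist R d a.
have [_ Df] := C1_comp (elementary_C1 ef).1 (is_derive_flat 1) (continuous_flat (p := _)).
have Dfi i x : partial i f x = k * (2 * (x ord0 i - a ord0 i)).
  rewrite /f (partialD _ _ (C1_cst _) (C1M (C1_cst _) Cq)) (partialM _ _ (C1_cst _) Cq) Dq.
  by rewrite /partial !derive_cst mulr0 addr0 add0r.
have Dv i x : partial i v x = b^-1 * (flat ('X^2 * (1 - 1^`())) (f x) * (k * (2 * (x ord0 i - a ord0 i)))).
  rewrite /v (partialM _ _ (C1_cst _) (elementary_C1 (elementary_flat 1 ef)).1).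
  by rewrite [X in _ * X + _]Df Dfi /partial derive_cst mulr0 addr0.
have gv x : eball a (2 * r) x -> enorm (grad v x) ^+ 2 <= (C * (9 / 4) / b) ^+ 2 * 16 / r ^+ 2.
  move=> /eballE => /(_ (mulr_ge0 (ler0n _ 2) (ltW r0))) xr.
  set F := flat ('X^2 * (1 - 1^`())) (f x).
  have FC : F ^+ 2 <= (C * (9 / 4)) ^+ 2.
    rewrite -(real_normK (num_real F)) ler_pXn2r ?nnegrE ?mulr_ge0//.
    rewrite /F; have [fx0|fx0] := leP (f x) 0; first by rewrite flat_le0E// normr0 mulr_ge0.
    apply: le_trans (HC _) _; rewrite ler_wpM2l// gtr0_norm// /f gerDl /k mulNr oppr_le0.
    by rewrite mulr_ge0 ?sqdist_ge0// invr_ge0 ltW.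
  have -> : enorm (grad v x) ^+ 2 = F ^+ 2 * ((b^-1 ^+ 2) * (4 * k ^+ 2 * sqdist a x)).
    rewrite enorm_gradE /sqdist !mulr_sumr; apply: eq_bigr => i _; rewrite Dv -/F; ring.
  have -> : (C * (9 / 4) / b) ^+ 2 * 16 / r ^+ 2 = (C * (9 / 4)) ^+ 2 * (b^-1 ^+ 2 * (16 / r ^+ 2)).
    by rewrite exprMn !mulrA.
  apply: ler_pM => //; first exact: sqr_ge0.
    by apply: mulr_ge0; [exact: sqr_ge0|rewrite mulr_ge0 ?sqdist_ge0// mulr_ge0 ?sqr_ge0].
  rewrite ler_wpM2l ?sqr_ge0//.
  have -> : 4 * k ^+ 2 * sqdist a x = (4 * sqdist a x / r ^+ 2) / r ^+ 2.
    by rewrite /k sqrrN; ring.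
  rewrite ler_pM2r ?invr_gt0// ler_pdivrMr//; move: xr; rewrite exprMn; lra.
have Cv : C1 v by exact: (elementary_C1 ev).1.
have mg := measurable_continuous (continuous_grad_sqr Cv).
have mb := measurable_open (@open_eball R d a (2 * r)).
pose K := (C * (9 / 4) / b) ^+ 2 * 16 / r ^+ 2.
have K0 : 0 <= K by apply: mulr_ge0; [apply: mulr_ge0 => //; exact: sqr_ge0|rewrite invr_ge0 ltW].
apply: (@le_trans _ _ (\int[lebesgue_rV d]_(x in eball a (2 * r)) K%:E)%E).
  apply: ge0_le_integral => //.
  - by move=> x _; rewrite lee_fin sqr_ge0.
  - by apply/measurable_EFinP; exact: measurable_funTS.
have -> : (\int[lebesgue_rV d]_(x in eball a (2 * r)) K%:E = K%:E * lebesgue_rV d (eball a (2 * r)))%E.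
  exact: (integral_cst _ mb).
apply: (@le_trans _ _ (K%:E * lebesgue_rV d (cbox a (2 * r)))%E).
  apply: lee_wpmul2l; first by rewrite lee_fin.
  by apply: le_measure; rewrite ?inE//; [exact: measurable_cbox|exact: eball_sub_cbox].
rewrite lebesgue_cbox ?mulr_ge0 ?(ltW r0)// -EFinM lee_fin.
have -> : 2 * (2 * r) = 4 * r by ring.
rewrite exprMn; have -> : K * (4 ^+ d * r ^+ d) = c * (r ^+ d / r ^+ 2) by rewrite /K /c; ring.
rewrite -mulrA ler_wpM2r ?lerDl//.
by rewrite divr_ge0 ?exprn_ge0 ?ltW.
Qed.
End test_functions.

(** * The fundamental lemma of the calculus of variations *)

Section fundamental_lemma.
Context {R : realType} {d : nat}.
Implicit Types (f g h phi psi : 'rV[R]_d -> R) (x y a : 'rV[R]_d) (U D : set 'rV[R]_d).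
Local Notation leb := (@lebesgue_rV R d).

Definition ratbox (p : 'rV[rat]_d * nat) : set 'rV[R]_d :=
  cbox (map_mx ratr p.1) p.2.+1%:R^-1.

Lemma ratbox_nbhs U x : open U -> U x -> exists p,
  ratbox p `<=` U /\ forall i, `|x ord0 i - map_mx ratr p.1 ord0 i| < p.2.+1%:R^-1.
Proof.
move=> oU Ux.
have /nbhs_ballP[e /= e0 eU] := open_nbhs_nbhs (conj oU Ux).
have [k _ /(_ k (leqnn _)) /= ke] := near_infty_natSinv_lt (PosNum (divr_gt0 e0 (@ltr0n R 2))).
have k0 : 0 < k.+1%:R^-1 :> R by rewrite invr_gt0.
have qP i : exists q : rat, `|x ord0 i - ratr q| < k.+1%:R^-1.
  have [|q] := @rat_in_itvoo R (x ord0 i - k.+1%:R^-1) (x ord0 i + k.+1%:R^-1).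
    by rewrite ltrD2l gtrN.
  by rewrite in_itv /= => hq; exists q; rewrite distrC ltr_distl.
have [q qE] := choice qP.
exists (\row_i q i, k); split => [y /cboxP /= yp|i /=]; last by rewrite !mxE; exact: qE.
apply: eU; split => // j i; rewrite (ord1 j) /ball /=.
have := yp i; have := qE i; rewrite !mxE => h1 h2.
rewrite [e]splitr (le_lt_trans (ler_distD (ratr (q i)) _ _))//.
by rewrite ltrD ?(lt_trans h1 ke)// distrC (le_lt_trans h2 ke).
Qed.

(* [phi_ k] is [exp (-1 / (k S))], [S] a finite sum of bumps supported in rational
   boxes contained in [U]. *)
Lemma open_exhaust U : open U -> exists phi_ : nat -> 'rV[R]_d -> R,
  (forall k, test_function U (phi_ k)) /\ (forall k x, 0 <= phi_ k x <= 1) /\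
  (forall x, U x -> phi_ k x @[k --> \oo] --> (1 : R)).
Proof.
move=> oU.
(* [j] runs over the rational boxes through [pickle]; codes of no box and boxes that leave [U]
   contribute 0. The product of one-variable bumps is positive exactly in the interior of its
   box. *)
pose m j x : R := if unpickle j is Some p then
  if `[< ratbox p `<=` U >] then
    \prod_i bump ((p.2.+1%:R^-1) ^+ 2 + (-1) * (x ord0 i - map_mx ratr p.1 ord0 i) ^+ 2)
  else 0 else 0.
have em j : elementary (m j).
  rewrite /m; case: unpickle => [p|]; last exact: elementary_cst.
  case: `[< _ >]; last exact: elementary_cst.
  apply: elementary_prod => i; apply: elementary_flat.
  apply: elementaryD; first exact: elementary_cst.
  apply: elementaryM; first exact: elementary_cst.
  under eq_fun do rewrite expr2.
  by apply: elementaryM; apply: elementaryD; (exact: elementary_coord || exact: elementary_cst).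
have m0 j x : 0 <= m j x.
  rewrite /m; case: unpickle => [p|]//; case: ifP => // _.
  by apply: prodr_ge0 => i _; exact: bump_ge0.
pose phi_ k x := bump (k.+1%:R * \sum_(j < k) m j x).
have K k : exists2 K : set 'rV[R]_d, compact K & K `<=` U /\ forall x, phi_ k x != 0 -> K x.
  have [K cK [KU Km]] : exists2 K : set 'rV[R]_d, compact K &
      K `<=` U /\ forall x, \sum_(j < k) m j x != 0 -> K x.
    elim: k => [|k [K cK [KU IH]]].
      exists set0; first exact: compact0.
      by split => // x; rewrite big_ord0 eqxx.
    have [L cL [LU mL]] : exists2 L : set 'rV[R]_d, compact L & L `<=` U /\ forall x, m k x != 0 -> L x.
      rewrite /m; case: unpickle => [p|]; last first.
        by exists set0; [exact: compact0|split => // x; rewrite eqxx].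
      case: (asboolP (ratbox p `<=` U)) => [pU|_]; last first.
        by exists set0; [exact: compact0|split => // x; rewrite eqxx].
      exists (ratbox p); first exact: compact_cbox.
      split => // x /prodf_neq0 xp; apply/cboxP => i; have := xp i isT.
      set t := (X in bump X) => t0; have : 0 < bump t by rewrite lt0r t0 bump_ge0.
      rewrite bump_gt0 /t mulN1r subr_gt0 -(real_normK (num_real (_ - _))).
      by rewrite ltr_pXn2r ?nnegrE// => /ltW.
    exists (K `|` L); first exact: compactU.
    split; first by move=> x [/KU|/LU].
    move=> x; rewrite big_ord_recr /= => s0.
    have [/IH|] := boolP (\sum_(j < k) m j x != 0); first by left.
    by rewrite negbK => /eqP h; right; apply: mL; move: s0; rewrite h add0r.
  exists K => //; split => // x; rewrite /phi_ => p0; apply: Km.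
  by apply: contraNneq p0 => ->; rewrite mulr0 /bump flat_le0E.
exists phi_; split; [|split].
- move=> k; have [L cL [LU pL]] := K k.
  have sL : supp (phi_ k) `<=` L.
    have clL : closed L by apply: compact_closed => //; exact: norm_hausdorff.
    by rewrite /supp closureE => x; apply; split.
  split.
  + apply: elementary_smooth; apply: elementary_flat.
    apply: elementaryM; first exact: elementary_cst.
    by apply: elementary_sum => j; exact: em.
  + apply: (@subclosed_compact _ _ L) => //; exact: closed_closure.
  + exact: subset_trans sL LU.
- by move=> k x; rewrite bump_ge0 bump_le1.
- move=> x Ux.
  have [p [pU xp]] := ratbox_nbhs oU Ux.
  pose j := pickle p.
  have mj : 0 < m j x.
    rewrite /m /j pickleK asboolT//; apply: prodr_gt0 => i _.
    rewrite bump_gt0 mulN1r subr_gt0 -(real_normK (num_real (_ - _))).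
    by rewrite ltr_pXn2r ?nnegrE// xp.
  (* From below a single box around [x] suffices: [(k + 1) m j x] tends to infinity, where
     [exp(-1/t)] tends to 1. *)
  have lower : bump (k.+1%:R * m j x) @[k --> \oo] --> (1 : R).
    have -> : (fun k => bump (k.+1%:R * m j x)) = (fun k => expR (- (harmonic k * (m j x)^-1))).
      apply/funext => k; rewrite /bump flat_gt0E ?mulr_gt0// hornerC mul1r.
      by rewrite invfM.
    rewrite -expR0; apply: continuous_cvg; first exact: continuous_expR.
    rewrite -oppr0; apply: cvgN; rewrite -(mul0r (m j x)^-1).
    apply: cvgMl; exact: cvg_harmonic.
  apply: (squeeze_cvgr _ lower (cvg_cst (1 : R))).
  near=> k; rewrite bump_le1 andbT; apply: bump_le.
  rewrite ler_wpM2l//; have jk : (j < k)%N by near: k; exact: nbhs_infty_gt.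
  by rewrite (bigD1 (Ordinal jk))//= lerDl sumr_ge0.
Unshelve. all: end_near. Qed.

Lemma L2loc_integrable D h psi : open D -> L2loc D h -> continuous psi ->
  compact (supp psi) -> supp psi `<=` D ->
  leb.-integrable (D : set (borel R d)) (fun x : borel R d => (h x * psi x)%:E).
Proof.
move=> oD [mh hK] cpsi cs sD.
have mD := measurable_open oD.
have mK : measurable (supp psi : set (borel R d)) by apply: measurable_closed; exact: closed_closure.
have mpsi := measurable_continuous cpsi.
have [M bM] := compact_boxed cs.
have iK : leb.-integrable (supp psi : set (borel R d)) (fun x : borel R d => (h x * psi x)%:E).
  apply: (@le_integrable _ _ _ _ _ mK _ (fun x : borel R d => (h x ^+ 2)%:E + (psi x * psi x)%:E)%E).
  - apply/measurable_EFinP; apply: measurable_funM; last exact: measurable_funTS.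
    exact: measurable_funS mh.
  - move=> x _; rewrite -EFinD !abse_EFin lee_fin [leRHS]ger0_norm; last first.
      by rewrite addr_ge0 ?sqr_ge0// -expr2 sqr_ge0.
    have := sqr_ge0 (h x - psi x); have := sqr_ge0 (h x + psi x).
    rewrite ler_norml; nra.
  - apply: integrableD => //.
      apply/integrableP; split.
        apply/measurable_EFinP; apply: measurable_funX; exact: measurable_funS mh.
      under eq_integral do rewrite gee0_abs ?lee_fin ?sqr_ge0//.
      exact: hK.
    apply: (@integrableS _ _ _ _ setT) => //.
    by apply: (@boxed_integrable _ _ M); [exact: contM|exact: boxedM].
have : leb.-integrable (D : set (borel R d)) ((fun x : borel R d => (h x * psi x)%:E) \_ (supp psi)).
  by apply/(integrable_restrict _ mK mD); rewrite setIidr.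
apply: eq_integrable => // x _; rewrite patchE; case: ifPn => // /negP; rewrite inE => ns.
by rewrite (notin_supp ns) mulr0.
Qed.

(** No mollifiers: indicators of open sets are limits of test functions, so the integral of [h]
    vanishes over the open subsets of a small box, and by a Dynkin argument over its Borel subsets.
    Countably many rational boxes cover [D]. *)
Lemma fundamental_lemma D h : open D -> L2loc D h ->
  (forall phi, test_function D phi -> \int[leb]_(x in D) (h x * phi x) = 0) ->
  {ae leb, forall x, D x -> h x = 0}.
Proof.
move=> oD Lh h0; have [mh hK] := Lh.
have mD := measurable_open oD.
(* The open box [V p] keeps its intersections with open sets open; the compact [ratbox p] containing
   it is where [L2loc] gives integrability. *)
pose V p : set 'rV[R]_d := ball (map_mx ratr p.1 : 'rV[R]_d) p.2.+1%:R^-1.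
have Vratbox p : V p `<=` ratbox p.
  move=> x [_ px]; apply/cboxP => i; rewrite distrC; apply: ltW; exact: px.
have oV p : open (V p) by exact: ball_open.
have local p : ratbox p `<=` D -> {ae leb, forall x, V p x -> h x = 0}.
  move=> pD.
  have mV := measurable_open (oV p).
  have VD : V p `<=` D by exact: subset_trans (Vratbox p) pD.
  have mhV : measurable_fun (V p : set (borel R d)) h by exact: measurable_funS mh.
  have iV : leb.-integrable (V p : set (borel R d)) (EFin \o h).
    apply: (@le_integrable _ _ _ _ _ mV _ (fun x : borel R d => (h x ^+ 2)%:E + 1%:E)%E).
    - exact/measurable_EFinP.
    - move=> x _; rewrite -EFinD !abse_EFin lee_fin [leRHS]ger0_norm ?addr_ge0 ?sqr_ge0//.
      have := sqr_ge0 (h x - 1); have := sqr_ge0 (h x + 1).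
      rewrite ler_norml; nra.
    - apply: integrableD => //.
        apply/integrableP; split.
          by apply/measurable_EFinP; apply: measurable_funX.
        under eq_integral do rewrite gee0_abs ?lee_fin ?sqr_ge0//.
        apply: (@le_lt_trans _ _ (\int[leb]_(x in ratbox p) (h x ^+ 2)%:E)%E).
          apply: ge0_subset_integral => //; first exact: measurable_cbox.
            apply/measurable_EFinP; apply: measurable_funX; exact: measurable_funS mh.
          by move=> x _; rewrite lee_fin sqr_ge0.
        by apply: hK => //; exact: compact_cbox.
      apply: (@measurable_bounded_integrable _ _ _ _ (cst 1)) => //.
        apply: (@le_lt_trans _ _ (leb (ratbox p))).
          by apply: le_measure; rewrite ?inE//; exact: measurable_cbox.
        by rewrite lebesgue_cbox ?ltry.
      by exists 1; split => // y y1 x _ /=; rewrite normr1 ltW.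
  have hU U : open U -> (\int[leb]_(x in U `&` V p) (h x)%:E = 0)%E.
    move=> oU; have oW : open (U `&` V p) by exact: openI.
    have mW := measurable_open oW.
    have [phi_ [tphi [phi01 phicvg]]] := open_exhaust oW.
    have WV : U `&` V p `<=` V p by exact: subIsetr.
    have WD : U `&` V p `<=` D by exact: subset_trans WV VD.
    have iW := integrableS mV mW WV iV.
    have mphi k := measurable_continuous (test_C1 (tphi k)).1.
    have z k : (\int[leb]_(x in U `&` V p) (h x * phi_ k x)%:E = 0)%E.
      have [sp cp sW] := tphi k.
      have tD : test_function D (phi_ k) by split => //; exact: subset_trans sW WD.
      have int := L2loc_integrable oD Lh (test_C1 tD).1 cp (subset_trans sW WD).
      transitivity (\int[leb]_(x in D) (h x * phi_ k x)%:E)%E.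
        rewrite -{1}(setIidr WD) integral_mkcondr; apply: eq_integral => x _.
        rewrite patchE; case: ifPn => // /negP; rewrite inE => nW.
        by rewrite (test_out (tphi k) nW).1 mulr0.
      have := h0 _ tD; rewrite /Rintegral => fz.
      by rewrite -(fineK (integrable_fin_num mD int)) fz.
    have : (\int[leb]_(x in U `&` V p) (h x * phi_ k x)%:E)%E @[k --> \oo] -->
        (\int[leb]_(x in U `&` V p) (h x)%:E)%E.
      apply: (@dominated_cvg _ _ _ _ _ mW _ _ (fun x => `|(h x)%:E|%E)).
      - move=> k; apply/measurable_EFinP; apply: measurable_funM; last exact: measurable_funTS.
        exact: measurable_funS mhV.
      - move=> x Wx; apply: cvg_EFin; first by near=> k.
        rewrite -[X in _ --> X](mulr1 (h x)); apply: cvgM; first exact: cvg_cst.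
        exact: phicvg.
      - by [].
      - exact: integrable_abse.
      - move=> k x _; rewrite lee_fin normrM ler_piMr//.
        by have /andP[p0 p1] := phi01 k x; rewrite ger0_norm.
    under eq_fun do rewrite z.
    by move=> /(cvg_lim (@ereal_hausdorff _)) <-; rewrite lim_cst.
  have iS (S : set (borel R d)) : measurable S ->
      leb.-integrable (S `&` V p) (fun x : borel R d => (h x)%:E).
    by move=> mS; apply: integrableS iV => //; exact: measurableI.
  have hS (S : set (borel R d)) : measurable S -> (\int[leb]_(x in S `&` V p) (h x)%:E = 0)%E.
    apply: (@dynkin_induction _ (borel R d) open
      (fun S => (\int[leb]_(x in S `&` V p) (h x)%:E = 0)%E)) => //.
    - by move=> A B; exact: openI.
    - exact: hU openT.
    - move=> A mA A0.
      have := hU _ openT; rewrite setTI.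
      have {1}-> : V p = (A `&` V p) `|` (~` A `&` V p) by rewrite -setIUl setUCr setTI.
      rewrite integral_setU ?A0 ?add0e//.
      + exact: measurableI.
      + by apply: measurableI => //; exact: measurableC.
      + by rewrite -setIUl setUCr setTI; apply/measurable_EFinP.
      + by apply/disj_setPS => x [[Ax _] [nAx _]].
    - move=> F mF tF F0.
      rewrite setI_bigcupl integral_bigcup.
      + by rewrite eseries0.
      + by move=> k l _ _ [x [[Fk _] [Fl _]]]; apply: tF => //; exists x.
      + by move=> k; exact: measurableI.
      + by rewrite -setI_bigcupl; apply: iS; exact: bigcup_measurable.
  have [N [mN N0 NV]] : ae_eq leb (V p : set (borel R d)) (EFin \o h) (cst 0%E).
    apply: (integral_ae_eq mV iV) => // E EV mE.
    by rewrite integral0 -{1}(setIidl EV); exact: hS.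
  exists N; split => // x /= nx; apply: NV => /= hx; apply: nx => Vx.
  by have := hx Vx; case.
pose F j := if unpickle j is Some p then
  if `[< ratbox p `<=` D >] then ~` [set x | V p x -> h x = 0] else set0 else set0.
have FN : leb.-negligible (\bigcup_j F j : set (borel R d)).
  apply: negligible_bigcup => j; rewrite /F.
  case: unpickle => [p|]; last exact: negligible_set0.
  by case: asboolP => [/local//|_]; exact: negligible_set0.
have DF : ~` [set x : borel R d | D x -> h x = 0] `<=` \bigcup_j F j.
  move=> x /= /not_implyP[Dx hx]; have [p [pD xp]] := ratbox_nbhs oD Dx.
  exists (pickle p) => //; rewrite /F pickleK asboolT//= => /(_ _)/hx; apply.
  by split => // i j; rewrite (ord1 i) /ball /= distrC; exact: xp.
exact: negligibleS DF FN.
Unshelve. all: end_near. Qed.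
End fundamental_lemma.

(** * Energy estimate for variational solutions *)

Section energy.
Context {R : realType} {d : nat}.
Implicit Types (F f h phi psi u : 'rV[R]_d -> R) (g e : 'rV[R]_d -> 'rV[R]_d).
Implicit Types (x y a : 'rV[R]_d) (U D : set 'rV[R]_d) (A : 'rV[R]_d -> 'M[R]_d).
Local Notation leb := (@lebesgue_rV R d).

Lemma test_partial D phi i : test_function D phi -> test_function D (partial i phi).
Proof.
move=> [sp cp sD].
have ss : supp (partial i phi) `<=` supp phi.
  rewrite {1}/supp closureE => x; apply; split; first exact: closed_closure.
  by move=> y /= h; apply: contrapT => /(partial_notin_supp i) h0; rewrite h0 eqxx in h.
split; first by move=> s; have := sp (rcons s i); rewrite foldr_rcons.
- by apply: (@subclosed_compact _ _ (supp phi)) => //; exact: closed_closure.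
- exact: subset_trans ss sD.
Qed.

Lemma L2loc_test_integrable D h phi : open D -> L2loc D h -> test_function D phi ->
  leb.-integrable (D : set (borel R d)) (fun x : borel R d => (h x * phi x)%:E).
Proof.
by move=> oD Lh tp; have [sp cp sD] := tp; exact: L2loc_integrable oD Lh (test_C1 tp).1 cp sD.
Qed.

Lemma L2_loc D h : open D -> L2 D h -> L2loc D h.
Proof.
move=> oD [mh hD]; split => // K cK KD; apply: le_lt_trans hD.
apply: ge0_subset_integral => //.
- by apply: measurable_closed; apply: compact_closed => //; exact: norm_hausdorff.
- exact: measurable_open.
- exact/measurable_EFinP/measurable_funX.
- by move=> x _; rewrite lee_fin sqr_ge0.
Qed.

Lemma L2loc_boxed D M h : continuous h -> boxed M h -> L2loc D h.
Proof.
move=> ch bh; have mh := measurable_continuous ch.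
split => [|K cK KD]; first exact: measurable_funTS.
have mK : measurable (K : set (borel R d)).
  by apply: measurable_closed; apply: compact_closed => //; exact: norm_hausdorff.
have : leb.-integrable setT (fun x : borel R d => (h x * h x)%:E).
  by apply: (@boxed_integrable _ _ M); [exact: contM|exact: boxedM].
move=> /(integrableS measurableT mK (@subsetT _ _))/integrableP[_].
by under eq_integral do rewrite gee0_abs ?lee_fin -?expr2 ?sqr_ge0//.
Qed.

Lemma L2locB D f h : open D -> L2loc D f -> L2loc D h -> L2loc D (fun x => f x - h x).
Proof.
move=> oD [mf fK] [mh hK]; split => [|K cK KD]; first exact: measurable_funB.
have mK : measurable (K : set (borel R d)).
  by apply: measurable_closed; apply: compact_closed => //; exact: norm_hausdorff.
have mfK : measurable_fun (K : set (borel R d)) f by exact: (measurable_funS (measurable_open oD) KD mf).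
have mhK : measurable_fun (K : set (borel R d)) h by exact: (measurable_funS (measurable_open oD) KD mh).
apply: (@le_lt_trans _ _ (\int[leb]_(x in K) (2%:E * (f x ^+ 2)%:E + 2%:E * (h x ^+ 2)%:E))%E).
  apply: ge0_le_integral => //.
  - by move=> x _; rewrite lee_fin sqr_ge0.
  - by apply/measurable_EFinP/measurable_funX; exact: measurable_funB.
  - by apply: emeasurable_funD; apply: measurable_funeM; exact/measurable_EFinP/measurable_funX.
  - move=> x _; rewrite -!EFinM -EFinD lee_fin; have := sqr_ge0 (f x + h x); nra.
rewrite ge0_integralD//; first last.
- by apply: measurable_funeM; exact/measurable_EFinP/measurable_funX.
- by move=> x _; rewrite -EFinM lee_fin mulr_ge0 ?sqr_ge0.
- by apply: measurable_funeM; exact/measurable_EFinP/measurable_funX.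
- by move=> x _; rewrite -EFinM lee_fin mulr_ge0 ?sqr_ge0.
rewrite !ge0_integralZl//; try by [exact/measurable_EFinP/measurable_funX|move=> x _; rewrite lee_fin sqr_ge0].
by rewrite lte_add_pinfty// lte_mul_pinfty// ?fK ?hK.
Qed.

Lemma integral_by_parts D M F phi i : open D -> C1 F -> boxed M F -> test_function D phi ->
  \int[leb]_(x in D) (F x * partial i phi x) = - \int[leb]_(x in D) (partial i F x * phi x).
Proof.
move=> oD CF bF tp; have mD := measurable_open oD.
have Cp := test_C1 tp.
have i1 := L2loc_test_integrable oD (L2loc_boxed D CF.1 bF) (test_partial i tp).
have i2 := L2loc_test_integrable oD (L2loc_boxed D (CF.2 i).2 (boxed_partial i bF)) tp.
apply/eqP; rewrite -addr_eq0 -RintegralD//; apply/eqP.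
rewrite /Rintegral -[RHS](_ : fine 0%E = 0)// -(integral_partial i (C1M CF Cp) (boxedM phi bF)).
congr fine; rewrite integral_mkcond; apply: eq_integral => x _; rewrite patchE.
rewrite (partialM _ _ CF Cp) [_ * phi x]mulrC; case: ifPn => // /negP; rewrite inE => nD.
by have [-> ->] := test_out tp nD; rewrite mulr0 mul0r addr0.
Qed.

(** [g] comes from [weak_solution] and [g'] from [W120], two unrelated existentials. The classical
    gradient of the [C1] function [F] is also a weak one, so the difference of both sides is
    orthogonal to all test functions. *)
Lemma weak_gradient_unique D M F u g g' : open D -> C1 F -> boxed M F ->
  W12loc D u g -> (forall i, L2 D (fun x => g' x ord0 i)) ->
  weak_gradient D (u \- F) g' ->
  {ae leb, forall x, D x -> g x = grad F x + g' x}.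
Proof.
move=> oD CF bF [Lu Lg wu] Lg' wuF; have mD := measurable_open oD.
have ae_i i : {ae leb, forall x, D x -> g x ord0 i - partial i F x - g' x ord0 i = 0}.
  have LF := L2loc_boxed D (CF.2 i).2 (boxed_partial i bF).
  have Lg'i := L2_loc oD (Lg' i).
  apply: (fundamental_lemma oD).
    by apply: L2locB => //; exact: L2locB.
  move=> phi tp.
  have := wuF i phi tp.
  have -> : \int[leb]_(x in D) ((u \- F) x * partial i phi x) =
     \int[leb]_(x in D) (u x * partial i phi x) - \int[leb]_(x in D) (F x * partial i phi x).
    rewrite -RintegralB//.
    - by apply: eq_Rintegral => x _; rewrite /= mulrBl.
    - exact: L2loc_test_integrable (test_partial i tp).
    - exact: L2loc_test_integrable (L2loc_boxed D CF.1 bF) (test_partial i tp).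
  rewrite (wu i phi tp) (integral_by_parts i oD CF bF tp) => E.
  have -> : \int[leb]_(x in D) ((g x ord0 i - partial i F x - g' x ord0 i) * phi x) =
    \int[leb]_(x in D) (g x ord0 i * phi x) - \int[leb]_(x in D) (partial i F x * phi x)
     - \int[leb]_(x in D) (g' x ord0 i * phi x).
    have ig := L2loc_test_integrable oD (Lg i) tp.
    have iF := L2loc_test_integrable oD LF tp.
    have ig' := L2loc_test_integrable oD Lg'i tp.
    rewrite -RintegralB// -RintegralB//; last exact: (integrableB mD ig iF).
    by apply: eq_Rintegral => x _; rewrite !mulrBl.
  lra.
have : \forall x \ae leb, forall i, D x -> g x ord0 i - partial i F x - g' x ord0 i = 0.
  exact: filter_forall.
apply: (@filterS _ (almost_everywhere leb)) => x hx Dx; apply/rowP => i; rewrite !mxE.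
by have := hx i Dx; lra.
Qed.
End energy.

(** * Testing the equation: energy of the datum plus a test function *)

Section energy_estimate.
Context {R : realType} {d : nat}.
Implicit Types (F f h phi psi u : 'rV[R]_d -> R) (g e : 'rV[R]_d -> 'rV[R]_d).
Implicit Types (x y a : 'rV[R]_d) (U D : set 'rV[R]_d) (A : 'rV[R]_d -> 'M[R]_d).
Local Notation leb := (@lebesgue_rV R d).

Lemma edotDr x y z : edot x (y + z) = edot x y + edot x z :> R.
Proof. by rewrite -big_split/=; apply: eq_bigr => i _; rewrite mxE mulrDr. Qed.

Lemma enorm_sqrD x y : enorm (x + y) ^+ 2 <= 2 * enorm x ^+ 2 + 2 * enorm y ^+ 2.
Proof.
rewrite !enormE !mulr_sumr -big_split/=; apply: ler_sum => i _; rewrite mxE.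
have := sqr_ge0 (x ord0 i - y ord0 i); nra.
Qed.

(** Here [xi] is the gradient of the solution, [b] that of the datum, [c] that of a test function
    and [z] the approximation error. The pairing with [c] is kept exact because the equation makes
    it integrate to 0; the pairing with [b + z] is absorbed by Young's inequality, which costs
    [Lambda ^+ 4]. *)
Lemma elliptic_pointwise (Lambda : R) (B : 'M[R]_d) (xi b c z : 'rV[R]_d) : 1 <= Lambda ->
  Lambda^-1 * enorm xi ^+ 2 <= edot (xi *m B^T) xi ->
  (forall eta, `|edot (xi *m B^T) eta| <= Lambda * enorm xi * enorm eta) ->
  xi = b + (z + c) ->
  enorm (b + c) ^+ 2 <= 4 * Lambda * edot (xi *m B^T) c
    + 6 * Lambda ^+ 4 * (enorm b ^+ 2 + enorm z ^+ 2).
Proof.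
move=> L1 lo up xiE; have L0 : 0 < Lambda by exact: lt_le_trans L1.
set p := edot _ c.
have -> : b + c = xi + - z by rewrite xiE; apply/rowP => i; rewrite !mxE; ring.
have h1 := enorm_sqrD xi (- z); rewrite enormN in h1.
have h2 := enorm_sqrD b z.
have : edot (xi *m B^T) xi = p + edot (xi *m B^T) (b + z).
  by rewrite /p {2}xiE -edotDr; congr edot; apply/rowP => i; rewrite !mxE; ring.
have h3 := le_trans (ler_norm _) (up (b + z)).
move: lo => /[swap] -> h4.
set X := enorm xi in h1 h3 h4 *; set Y := enorm (b + z) in h2 h3.
set bb := enorm b ^+ 2 in h2 *; set zz := enorm z ^+ 2 in h1 h2 *.
have h5 : X ^+ 2 <= Lambda * p + Lambda ^+ 2 * X * Y.
  have : Lambda * (Lambda^-1 * X ^+ 2) <= Lambda * (p + Lambda * X * Y).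
    by rewrite ler_pM2l//; lra.
  by rewrite mulrA mulfV ?gt_eqF// mul1r => /le_trans; apply; rewrite mulrDr; lra.
have h6 : 2 * (Lambda ^+ 2 * X * Y) <= X ^+ 2 + Lambda ^+ 4 * Y ^+ 2.
  have := sqr_ge0 (X - Lambda ^+ 2 * Y).
  have -> : (X - Lambda ^+ 2 * Y) ^+ 2 = X ^+ 2 + Lambda ^+ 4 * Y ^+ 2 - 2 * (Lambda ^+ 2 * X * Y) by ring.
  lra.
have L4 : 1 <= Lambda ^+ 4 by rewrite exprn_ege1.
have zz0 : 0 <= zz by exact: sqr_ge0.
have bb0 : 0 <= bb by exact: sqr_ge0.
have h7 : Lambda ^+ 4 * Y ^+ 2 <= Lambda ^+ 4 * (2 * bb + 2 * zz).
  by rewrite ler_wpM2l// exprn_ge0// ltW.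
have h8 : zz <= Lambda ^+ 4 * zz by rewrite ler_peMl.
have h9 : 0 <= Lambda ^+ 4 * bb by rewrite mulr_ge0// exprn_ge0// ltW.
have -> : 6 * Lambda ^+ 4 * (bb + zz) = 6 * (Lambda ^+ 4 * bb) + 6 * (Lambda ^+ 4 * zz) by ring.
have E1 : Lambda ^+ 4 * (2 * bb + 2 * zz) = 2 * (Lambda ^+ 4 * bb) + 2 * (Lambda ^+ 4 * zz) by ring.
rewrite -mulrA; lra.
Qed.

Lemma boxed_le (M N : R) f : M <= N -> boxed M f -> boxed N f.
Proof. by move=> MN bf x i xi; apply: (bf x i); exact: le_lt_trans MN xi. Qed.

Lemma boxedD (M : R) f h : boxed M f -> boxed M h -> boxed M (fun x => f x + h x).
Proof. by move=> bf bh x i xi; rewrite (bf x i xi) (bh x i xi) addr0. Qed.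

Lemma gradD f h x : C1 f -> C1 h -> grad (fun x => f x + h x) x = grad f x + grad h x.
Proof. by move=> Cf Ch; apply/rowP => i; rewrite !mxE (partialD _ _ Cf Ch). Qed.

Lemma integrable_grad_sqr M f : C1 f -> boxed M f ->
  leb.-integrable setT (fun x : borel R d => (enorm (grad f x) ^+ 2)%:E).
Proof.
by move=> Cf bf; apply: (@boxed_integrable _ _ M); [exact: continuous_grad_sqr|exact: grad_boxed].
Qed.

Lemma L2_enorm_integrable D g : open D -> (forall i, L2 D (fun x => g x ord0 i)) ->
  leb.-integrable (D : set (borel R d)) (fun x : borel R d => (enorm (g x) ^+ 2)%:E).
Proof.
move=> oD Lg; have mD := measurable_open oD.
under eq_fun do rewrite enormE -sumEFin.
apply: integrable_sum => // i _; have [mg gi] := Lg i.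
apply/integrableP; split; first exact/measurable_EFinP/measurable_funX.
by under eq_integral do rewrite gee0_abs ?lee_fin ?sqr_ge0//.
Qed.

(** [F + phi] is a global [C1] substitute for the function equal to [u] in [D] and to [F] outside:
    it is close to it in [L^2], and its energy is controlled. *)
Lemma energy_estimate Lambda D A M F u (e : R) : 1 <= Lambda -> open D ->
  elliptic Lambda D A -> C1 F -> boxed M F -> weak_solution A D u -> W120 D (u \- F) ->
  0 < e -> exists2 phi, test_function D phi &
  (\int[leb]_(x in D) ((u x - F x - phi x) ^+ 2)%:E <= e%:E)%E /\
  (\int[leb]_x (enorm (grad (fun x => F x + phi x)%R x) ^+ 2)%:E <=
   (6 * Lambda ^+ 4)%:E * (\int[leb]_x (enorm (grad F x) ^+ 2)%:E + e%:E))%E.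
Proof.
move=> L1 oD [mA ellA] CF bF [g Wg sol] [g' [LuF Lg' wuF appr]] e0.
have mD := measurable_open oD.
have [phi tp phie] := appr e e0; exists phi => //.
have Cp := test_C1 tp; have [Mp bp] := test_boxed tp.
have [muF _] := LuF.
have mp : measurable_fun (D : set (borel R d)) phi.
  by apply: measurable_funTS; exact: measurable_continuous Cp.1.
pose eps x := g' x - grad phi x.
have mgrad i : measurable_fun (D : set (borel R d)) (partial i phi).
  by apply: measurable_funTS; exact: measurable_continuous (Cp.2 i).2.
have meps : measurable_fun (D : set (borel R d)) (fun x : borel R d => enorm (eps x) ^+ 2).
  under eq_fun do rewrite enormE.
  apply: measurable_sum => i; apply: measurable_funX.
  under eq_fun do rewrite !mxE.
  by apply: measurable_funB => //; exact: (Lg' i).1.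
have m1 : measurable_fun (D : set (borel R d)) (fun x : borel R d => ((u x - F x - phi x) ^+ 2)).
  by apply: measurable_funX; exact: measurable_funB.
split.
  apply: le_trans (ltW phie); apply: ge0_le_integral => //.
  - by move=> x _; rewrite lee_fin sqr_ge0.
  - exact/measurable_EFinP.
  - by apply/measurable_EFinP; exact: measurable_funD.
  - by move=> x _; rewrite lee_fin lerDl sqr_ge0.
have epse : (\int[leb]_(x in D) (enorm (eps x) ^+ 2)%:E <= e%:E)%E.
  apply: le_trans (ltW phie); apply: ge0_le_integral => //.
  - by move=> x _; rewrite lee_fin sqr_ge0.
  - exact/measurable_EFinP.
  - by apply/measurable_EFinP; exact: measurable_funD.
  - by move=> x _; rewrite lee_fin lerDr sqr_ge0.
have ieps : leb.-integrable (D : set (borel R d)) (fun x : borel R d => (enorm (eps x) ^+ 2)%:E).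
  apply/integrableP; split; first exact/measurable_EFinP.
  under eq_integral do rewrite gee0_abs ?lee_fin ?sqr_ge0//.
  by apply: le_lt_trans epse _; rewrite ltry.
pose P x := edot (g x *m (A x)^T) (grad phi x).
have mg i : measurable_fun (D : set (borel R d)) (fun x => g x ord0 i) by have [_ /(_ i)[]] := Wg.
have mP : measurable_fun (D : set (borel R d)) P.
  apply: measurable_sum => i; apply: measurable_funM.
    under eq_fun do rewrite mxE.
    apply: measurable_sum => j; apply: measurable_funM => //.
    by under eq_fun do rewrite mxE; exact: mA.
  by under eq_fun do rewrite mxE; exact: mgrad.
(* [N] collects the points where ellipticity or the identity of the two gradients fails; all
   pointwise bounds hold off [N]. *)
have [N [mN N0 DN]] : {ae leb, forall x, D x -> g x = grad F x + g' x /\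
    (forall xi, Lambda^-1 * enorm xi ^+ 2 <= edot (xi *m (A x)^T) xi) /\
    (forall xi eta, `|edot (xi *m (A x)^T) eta| <= Lambda * enorm xi * enorm eta)}.
  have := weak_gradient_unique oD CF bF Wg Lg' wuF.
  apply: (@filterS2 _ (almost_everywhere leb)) ellA => x h1 h2 Dx.
  by split; [exact: h2|exact: h1].
have good x : ~ N x -> D x -> g x = grad F x + g' x /\
    (forall xi, Lambda^-1 * enorm xi ^+ 2 <= edot (xi *m (A x)^T) xi) /\
    (forall xi eta, `|edot (xi *m (A x)^T) eta| <= Lambda * enorm xi * enorm eta).
  by move=> nN; apply: contrapT => h; apply: nN; exact: DN.
have iF := integrable_grad_sqr CF bF.
have iphi := integrable_grad_sqr Cp bp.
have L0 : 0 < Lambda by exact: lt_le_trans L1.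
(* The equation is stated with a real-valued integral, which is 0 also for an infinite one;
   integrability is what gives [P0] its meaning. *)
have iP : leb.-integrable (D : set (borel R d)) (fun x : borel R d => (P x)%:E).
  have mPE : measurable_fun (D : set (borel R d)) (fun x : borel R d => (P x)%:E) by exact/measurable_EFinP.
  apply/(negligible_integrable mN mD mPE N0).
  have mDN : measurable (D `\` N : set (borel R d)) by exact: measurableD.
  apply: (@le_integrable _ _ _ _ _ mDN _ (fun x : borel R d => Lambda%:E *
      ((enorm (grad F x) ^+ 2)%:E + (enorm (g' x) ^+ 2)%:E + (enorm (grad phi x) ^+ 2)%:E))%E).
  - exact: (measurable_funS mD (@subDsetl _ D N) mPE).
  - move=> x [Dx Nx]; have [gE [_ up]] := good x Nx Dx.
    rewrite -!EFinD -EFinM !abse_EFin lee_fin [leRHS]ger0_norm; last first.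
      by rewrite mulr_ge0 ?(ltW L0)// !addr_ge0 ?sqr_ge0.
    apply: le_trans (up _ _) _; rewrite -mulrA ler_wpM2l ?(ltW L0)//.
    have := enorm_sqrD (grad F x) (g' x); rewrite -gE.
    have := sqr_ge0 (enorm (g x) - enorm (grad phi x)); nra.
  - apply: integrableZl => //; apply: (integrableS mD mDN (@subDsetl _ D N)).
    have iFD := integrableS measurableT mD (@subsetT _ _) iF.
    have iphiD := integrableS measurableT mD (@subsetT _ _) iphi.
    have ig'D := L2_enorm_integrable oD Lg'.
    exact: (integrableD mD (integrableD mD iFD ig'D) iphiD).
have P0 : (\int[leb]_(x in D) (P x)%:E = 0)%E.
  by rewrite -(fineK (integrable_fin_num mD iP)); have := sol _ tp; rewrite /Rintegral => ->.
have CFp := C1D CF Cp.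
have bFp : boxed (Num.max M Mp) (fun x => F x + phi x).
  by apply: boxedD; [apply: boxed_le bF|apply: boxed_le bp]; rewrite le_max lexx ?orbT.
have iFp := integrable_grad_sqr CFp bFp.
(* Extension by 0 allows one pointwise inequality on the whole space: outside [D] the gradient of
   [phi] vanishes and only that of [F] remains. *)
pose PD := (fun x : borel R d => (P x)%:E) \_ D.
pose ED := (fun x : borel R d => (enorm (eps x) ^+ 2)%:E) \_ D.
have iPD : leb.-integrable setT PD by exact/(integrable_mkcond _ mD).
have iED : leb.-integrable setT ED by exact/(integrable_mkcond _ mD).
have i4P : leb.-integrable setT (fun x => (4 * Lambda)%:E * PD x)%E by exact: integrableZl.
have iFE : leb.-integrable setT (fun x : borel R d => (enorm (grad F x) ^+ 2)%:E + ED x)%E.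
  exact: (integrableD measurableT iF iED).
have i6 : leb.-integrable setT (fun x : borel R d => (6 * Lambda ^+ 4)%:E *
    ((enorm (grad F x) ^+ 2)%:E + ED x))%E by exact: integrableZl.
have iQ := integrableD measurableT i4P i6.
apply: (@le_trans _ _ (\int[leb]_x ((4 * Lambda)%:E * PD x + (6 * Lambda ^+ 4)%:E *
    ((enorm (grad F x) ^+ 2)%:E + ED x)))%E); last first.
  rewrite (integralD measurableT i4P i6) (integralZl measurableT iPD).
  rewrite (integralZl measurableT iFE) (integralD measurableT iF iED).
  rewrite /PD /ED -!integral_mkcond P0 mule0 add0e.
  apply: lee_wpmul2l; first by rewrite lee_fin mulr_ge0// exprn_ge0 ?ltW.
  exact: leeD2l.
rewrite (negligible_integral mN measurableT iFp N0) (negligible_integral mN measurableT iQ N0).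
have mTN : measurable (setT `\` N : set (borel R d)) by exact: measurableD.
apply: le_integral.
- exact: mTN.
- exact: (integrableS measurableT mTN (@subsetT _ _) iFp).
- exact: (integrableS measurableT mTN (@subsetT _ _) iQ).
move=> x; rewrite inE => -[_ Nx].
rewrite (gradD _ CF Cp) /PD /ED !patchE.
case: ifPn => [|/negP]; rewrite inE => Dx.
  change ((enorm (grad F x + grad phi x) ^+ 2)%:E <= (4 * Lambda * P x +
    6 * Lambda ^+ 4 * (enorm (grad F x) ^+ 2 + enorm (eps x) ^+ 2))%:E)%E.
  rewrite lee_fin; have [gE [lo up]] := good x Nx Dx.
  apply: elliptic_pointwise => //.
  by rewrite gE /eps; congr +%R; rewrite subrK.
have -> : grad phi x = 0 by apply/rowP => i; rewrite !mxE (test_out tp Dx).2.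
change ((enorm (grad F x + 0) ^+ 2)%:E <= (4 * Lambda * 0 +
  6 * Lambda ^+ 4 * (enorm (grad F x) ^+ 2 + 0))%:E)%E.
rewrite lee_fin !addr0 mulr0 add0r ler_peMl ?sqr_ge0//.
have : 1 <= Lambda ^+ 4 by rewrite exprn_ege1.
lra.
Qed.
End energy_estimate.

(** * Competitors *)

Section local_bound.
Context {R : realType} {d : nat}.
Implicit Types (F f h phi psi u v : 'rV[R]_d -> R).
Implicit Types (x y a : 'rV[R]_d) (U D : set 'rV[R]_d) (A : 'rV[R]_d -> 'M[R]_d).
Local Notation leb := (@lebesgue_rV R d).

(** The constant is [96 = 2 * 8 * 6]: splitting a square, Hardy's inequality on the ball, and the
    energy estimate. The approximation error is arbitrary and disappears. *)
Lemma local_bound Lambda D A M F u a (s : R) : (2 < d)%N -> 1 <= Lambda -> open D ->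
  elliptic Lambda D A -> C1 F -> boxed M F -> weak_solution A D u -> W120 D (u \- F) ->
  0 < s ->
  (\int[leb]_(x in eball a s) ((F x + ((u \- F) \_ D) x)%R ^+ 2)%:E <=
   (96 * s ^+ 2 * Lambda ^+ 4)%:E * \int[leb]_x (enorm (grad F x) ^+ 2)%:E)%E.
Proof.
move=> d2 L1 oD ellA CF bF wu WuF s0; apply/lee_addgt0Pr => e e0.
have mD := measurable_open oD; have mB := measurable_open (@open_eball R d a s).
pose k := 96 * s ^+ 2 * Lambda ^+ 4.
have k0 : 0 <= k by rewrite /k mulr_ge0 ?exprn_ge0 ?(le_trans ler01 L1)// mulr_ge0 ?sqr_ge0.
(* The error enters once through the energy, with factor [k], and once through the [L^2] distance,
   with factor 2. *)
pose e1 := e / (k + 2).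
have k2 : 0 < k + 2 by rewrite ltr_wpDl.
have e10 : 0 < e1 by rewrite divr_gt0.
have [phi tp [phi1 phi2]] := energy_estimate L1 oD ellA CF bF wu WuF e10.
have Cp := test_C1 tp; have [Mp bp] := test_boxed tp.
pose w : 'rV[R]_d -> R := (u \- F) \_ D.
have [_ [[mw _] _ _ _]] := WuF.
have mwT : measurable_fun setT (w : borel R d -> R) by exact/(measurable_restrictT _ mD).
have mF := measurable_continuous CF.1.
have mp := measurable_continuous Cp.1.
have CFp := C1D CF Cp.
have bFp : boxed (Num.max M Mp) (fun x => F x + phi x).
  by apply: boxedD; [apply: boxed_le bF|apply: boxed_le bp]; rewrite le_max lexx ?orbT.
apply: (@le_trans _ _ (\int[leb]_(x in eball a s)
   (2%:E * ((F x + phi x) ^+ 2)%:E + 2%:E * ((w x - phi x) ^+ 2)%:E))%E).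
  apply: ge0_le_integral => //.
  - by move=> x _; rewrite lee_fin sqr_ge0.
  - by apply/measurable_EFinP/measurable_funX/measurable_funTS; exact: measurable_funD.
  - apply: emeasurable_funD; apply: measurable_funeM; apply/measurable_EFinP/measurable_funX/measurable_funTS.
      exact: measurable_funD.
    exact: measurable_funB.
  - move=> x _; rewrite -!EFinM -EFinD lee_fin.
    have := sqr_ge0 (F x + phi x - (w x - phi x)); rewrite /w; nra.
rewrite ge0_integralD//; first last.
- by apply: measurable_funeM; apply/measurable_EFinP/measurable_funX/measurable_funTS; exact: measurable_funB.
- by move=> x _; rewrite -EFinM lee_fin mulr_ge0 ?sqr_ge0.
- by apply: measurable_funeM; apply/measurable_EFinP/measurable_funX/measurable_funTS; exact: measurable_funD.
- by move=> x _; rewrite -EFinM lee_fin mulr_ge0 ?sqr_ge0.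
rewrite !ge0_integralZl//; first last.
- by move=> x _; rewrite lee_fin sqr_ge0.
- by apply/measurable_EFinP/measurable_funX/measurable_funTS; exact: measurable_funD.
- by move=> x _; rewrite lee_fin sqr_ge0.
- by apply/measurable_EFinP/measurable_funX/measurable_funTS; exact: measurable_funB.
have hb := hardy_ball a d2 s0 CFp bFp.
have wb : (\int[leb]_(x in eball a s) ((w x - phi x) ^+ 2)%:E <= e1%:E)%E.
  apply: le_trans phi1.
  apply: (@le_trans _ _ (\int[leb]_x ((w x - phi x) ^+ 2)%:E)%E).
    apply: ge0_subset_integral => //; last by move=> x _; rewrite lee_fin sqr_ge0.
    by apply/measurable_EFinP/measurable_funX; exact: measurable_funB.
  rewrite [leRHS]integral_mkcond le_eqVlt; apply/orP; left; apply/eqP; apply: eq_integral => x _.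
  rewrite /w !patchE; case: ifPn => // /negP; rewrite inE => nD.
  by rewrite (test_out tp nD).1 subr0 expr0n.
have iF := integrable_fin_num measurableT (integrable_grad_sqr CF bF).
rewrite -(fineK iF) in phi2 *; set I := fine _ in phi2 *.
have L40 : 0 <= Lambda ^+ 4 by rewrite exprn_ge0 ?(le_trans ler01 L1).
have hb2 := le_trans hb (lee_wpmul2l _ phi2).
apply: (@le_trans _ _ (2%:E * ((8 * s ^+ 2)%:E * ((6 * Lambda ^+ 4)%:E * (I%:E + e1%:E))) + 2%:E * e1%:E)%E).
  apply: leeD; apply: lee_wpmul2l => //.
  by apply: hb2; rewrite lee_fin mulr_ge0 ?sqr_ge0.
change ((2 * (8 * s ^+ 2 * (6 * Lambda ^+ 4 * (I + e1))) + 2 * e1)%:E <= (k * I + e)%:E)%E.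
rewrite lee_fin.
have -> : 2 * (8 * s ^+ 2 * (6 * Lambda ^+ 4 * (I + e1))) + 2 * e1 = k * I + (k + 2) * e1 by rewrite /k; ring.
by rewrite /e1 [(k + 2) * _]mulrC divfK ?gt_eqF.
Qed.

Lemma partial_bound_line F i (K : R) x (c : R) : C1 F -> (forall y, `|partial i F y| <= K) ->
  `|F (c *: delta_mx ord0 i + x) - F x| <= K * `|c|.
Proof.
move=> CF HK; pose p := fun t : R => t *: delta_mx ord0 i + x : 'rV[R]_d.
have pE (t l : R) : p (l *: (1 : R) + t) = l *: delta_mx ord0 i + p t.
  by rewrite /p [l *: 1]mulr1 scalerDl addrA.
have dp (t : R) : is_derive t 1 (F \o p) (partial i F (p t)).
  apply: DeriveDef; first by apply/(derivable_affine F (pE t)); exact: (CF.2 i).1.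
  exact: (derive_affine F (pE t)).
have p0 : p 0 = x by rewrite /p scale0r add0r.
have cp : continuous (F \o p).
  by move=> t; apply/differentiable_continuous/derivable1_diffP; have [] := dp t.
have cw (b e : R) : {within `[b, e], continuous (F \o p)} by exact: continuous_subspaceT.
rewrite -{2}p0 -/(p c).
have [c0|c0|->] := ltgtP c 0.
- have [t _ /= E] := MVT c0 (fun t _ => dp t) (@cw c 0).
  by rewrite distrC E normrM sub0r normrN ler_wpM2r.
- have [t _ /= E] := MVT c0 (fun t _ => dp t) (@cw 0 c).
  by rewrite E normrM subr0 ler_wpM2r.
- by rewrite subrr !normr0 mulr0.
Qed.

Lemma C1_lipschitz M F : C1 F -> boxed M F ->
  exists2 L : R, 0 <= L & forall x y, `|F x - F y| <= L * `|x - y|.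
Proof.
move=> CF bF.
have KP i : exists K, forall y, `|partial i F y| <= K.
  by have [K _ HK] := boxed_bounded (CF.2 i).2 (boxed_partial i bF); exists K.
have [K HK] := choice KP.
have K0 i : 0 <= K i by apply: le_trans (HK i 0).
exists (\sum_i K i) => [|x y]; first exact: sumr_ge0.
(* [z k] has the first [k] coordinates of [x] and the others of [y]; the increment telescopes over
   moves along coordinate lines. *)
pose z (k : nat) : 'rV[R]_d := \row_i (if (i < k)%N then x ord0 i else y ord0 i).
have -> : x = z d by apply/rowP => i; rewrite mxE ltn_ord.
have z0 : y = z 0%N by apply/rowP => i; rewrite mxE.
rewrite {1}z0 -(telescope_sumr (F \o z))// big_mkord.
apply: le_trans (ler_norm_sum _ _ _) _; rewrite mulr_suml; apply: ler_sum => i _ /=.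
have -> : z i.+1 = (x ord0 i - y ord0 i) *: delta_mx ord0 i + z i.
  apply/rowP => j; rewrite !mxE eqxx /= ltnS leq_eqVlt -val_eqE /=.
  case: eqP => [/val_inj ->|_] /=; last by rewrite mulr0 add0r.
  by rewrite ltnn mulr1 subrK.
apply: le_trans (partial_bound_line _ _ CF (HK i)) _.
rewrite ler_wpM2l//; apply: le_trans (coord_le_norm _ i).
by rewrite !mxE ltn_ord.
Qed.

Lemma boxed_lipschitz M F (S : set 'rV[R]_d) : C1 F -> boxed M F -> [lipschitz F x | x in S].
Proof.
move=> CF bF; have [L L0 HL] := C1_lipschitz CF bF.
exists L; split; first exact: num_real.
move=> K LK [x y] /= _; apply: le_trans (HL x y) _.
by rewrite ler_wpM2r// ltW.
Qed.

(** The squared positive part is [C1] where the positive part is not. [C1] is enough for the datum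
    [F]; only [v] and [phi] are smooth. *)
Definition sqplus (t : R) := if 0 < t then t ^+ 2 else 0.

Lemma is_derive_sqplus (t : R) : is_derive t 1 sqplus (t + `|t|).
Proof.
have [t0|t0|->] := ltgtP t 0.
- rewrite ltr0_norm// subrr.
  have := is_derive_cst (0 : R) t (1 : R); apply: near_eq_is_derive.
  near=> y; rewrite /sqplus ifN// -leNgt ltW//; near: y; exact: lt_nbhsl.
- rewrite gtr0_norm//.
  have h : is_derive t 1 (fun y : R => y ^+ 2) (t + t).
    have h := is_deriveM (is_derive_id t (1 : R)) (is_derive_id t (1 : R)).
    by apply: is_derive_eq h _; rewrite /GRing.scale /= mulr1.
  move: h; apply: near_eq_is_derive.
  near=> y; rewrite /sqplus ifT//; near: y; exact: lt_nbhsr.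
- rewrite normr0 addr0.
  have s0 : sqplus 0 = 0 by rewrite /sqplus ltxx.
  have cv : (fun h : R => h^-1 *: ((sqplus \o shift 0) (h *: 1) - sqplus 0)) @ 0^' --> (0 : R).
    apply/cvgr0Pnorm_lt => e e0; near=> h.
    have h0 : h != 0 by near: h; exact: nbhs_dnbhs_neq.
    rewrite /= addr0 s0 subr0 [h *: 1]mulr1 /sqplus; case: ifP => _; last by rewrite scaler0 normr0.
    rewrite expr2 [_ *: _]mulKf//; near: h; exact: dnbhs0_lt.
  by apply: DeriveDef; [apply/cvg_ex; exists 0; exact: cv|exact/cvg_lim/cv].
Unshelve. all: end_near. Qed.

Lemma continuous_sqplus' : continuous (fun t : R => t + `|t|).
Proof. by apply: contD => x; [exact: cvg_id|exact: norm_continuous]. Qed.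

Lemma sqplus_pos (t : R) : 0 < t -> sqplus t = t ^+ 2.
Proof. by rewrite /sqplus => ->. Qed.

Lemma sqplus_npos (t : R) : t <= 0 -> sqplus t = 0.
Proof. by rewrite /sqplus ltNge => ->. Qed.
End local_bound.

(** * Passage to the limit in the local bound, and the boundary bump *)

Section competitor.
Context {R : realType} {d : nat}.
Implicit Types (F f h phi psi u v : 'rV[R]_d -> R).
Implicit Types (x y z a : 'rV[R]_d) (U D : set 'rV[R]_d) (A : 'rV[R]_d -> 'M[R]_d).
Local Notation leb := (@lebesgue_rV R d).

(** Truncating the square at [1/4 = (1/2)^2] provides a constant dominating function, so an eventual
    pointwise lower bound 1/2 is all that is asked of the [u_ N]. *)
Lemma liminf_bound (Lambda : R) (D_ : nat -> set ('rV[R]_d)) A M F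
    (u_ : nat -> 'rV[R]_d -> R) a (s : R) : (2 < d)%N -> 1 <= Lambda ->
  (forall N, open (D_ N)) -> (forall N, elliptic Lambda (D_ N) A) ->
  C1 F -> boxed M F -> (forall N, weak_solution A (D_ N) (u_ N)) ->
  (forall N, W120 (D_ N) (u_ N \- F)) -> 0 < s ->
  (forall x, eball a s x ->
    \forall N \near \oo, 1 / 2 <= F x + ((u_ N \- F) \_ (D_ N)) x) ->
  (4^-1%:E * leb (eball a s) <=
   (96 * s ^+ 2 * Lambda ^+ 4)%:E * \int[leb]_x (enorm (grad F x) ^+ 2)%:E)%E.
Proof.
move=> d2 L1 oD ellA CF bF wu WuF s0 big.
have mB := measurable_open (@open_eball R d a s).
pose g N x := Num.min (1 / 4) ((F x + ((u_ N \- F) \_ (D_ N)) x) ^+ 2).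
have mg0 N : measurable_fun setT (fun x : borel R d => (F x + ((u_ N \- F) \_ (D_ N)) x) ^+ 2).
  apply: measurable_funX; apply: measurable_funD; first exact: measurable_continuous CF.1.
  have [_ [[mw _] _ _ _]] := WuF N.
  by apply/(measurable_restrictT _ (measurable_open (oD N))).
have mg N : measurable_fun (eball a s : set (borel R d)) (fun x : borel R d => (g N x)%:E).
  by apply/measurable_EFinP/measurable_funTS; exact: measurable_minr.
have g0 N x : 0 <= g N x by rewrite /g le_min divr_ge0 ?sqr_ge0.
have lb N : (\int[leb]_(x in eball a s) (g N x)%:E <=
   (96 * s ^+ 2 * Lambda ^+ 4)%:E * \int[leb]_x (enorm (grad F x) ^+ 2)%:E)%E.
  apply: le_trans (local_bound a d2 L1 (oD N) (ellA N) CF bF (wu N) (WuF N) s0).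
  apply: ge0_le_integral => //.
  - by move=> x _; rewrite lee_fin.
  - by apply/measurable_EFinP; exact: measurable_funTS.
  - by move=> x _; rewrite lee_fin /g ge_min lexx orbT.
have : (\int[leb]_(x in eball a s) (g N x)%:E)%E @[N --> \oo] -->
    (\int[leb]_(x in eball a s) (1 / 4)%:E)%E.
  apply: (@dominated_cvg _ _ _ _ _ mB _ _ (fun=> (1 / 4)%:E)) => //.
  - move=> x Bx; apply: (@cvg_trans _ ((fun=> (1 / 4)%:E) @ \oo)); last exact: cvg_cst.
    apply: near_eq_cvg; near=> N; congr EFin; rewrite /g min_l//.
    have h : 1 / 2 <= F x + ((u_ N \- F) \_ (D_ N)) x by near: N; exact: big.
    have : (1 / 2) ^+ 2 <= (F x + ((u_ N \- F) \_ (D_ N)) x) ^+ 2.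
      by rewrite ler_pXn2r ?nnegrE//; lra.
    by apply: le_trans; lra.
  - apply: (@measurable_bounded_integrable _ _ _ _ (cst (1 / 4))) => //.
      apply: (@le_lt_trans _ _ (leb (cbox a s))).
        by apply: le_measure; rewrite ?inE//; [exact: measurable_cbox|exact: eball_sub_cbox].
      by rewrite lebesgue_cbox ?ltry// ltW.
    exists (1 / 4); split; first exact: num_real.
    by move=> y y4 x _ /=; rewrite ger0_norm ?ltW.
  - by move=> N x _; rewrite lee_fin ger0_norm// /g ge_min lexx.
have -> : (\int[leb]_(x in eball a s) (1 / 4)%:E = 4^-1%:E * leb (eball a s))%E.
  by rewrite div1r; exact: (integral_cst _ mB).
move=> cv; rewrite -(cvg_lim (@ereal_hausdorff _) cv).
apply: lime_le; first by apply/cvg_ex; eexists; exact: cv.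
by near=> N; exact: lb.
Unshelve. all: end_near. Qed.

(** The bump [f] of the overview. Its radius [r / 2] is the distance from [x] at which a further
    boundary point is guaranteed, and it keeps the support within the ball where [v] is at least 1
    off the domain. *)
Definition cutoff a (r : R) y : R := sqplus (1 + - (4 / r ^+ 2) * sqdist a y).

(** Written as a polynomial in a Lipschitz function with values in [[0,1]], from which bounds and
    the Lipschitz constant can be read off. *)
Lemma cutoffE a r y : 0 < r ->
  cutoff a r y = (1 - Num.min (2 * enorm (y - a) / r) 1 ^+ 2) ^+ 2.
Proof.
move=> r0; rewrite /cutoff sqdistE.
set T := 2 * enorm (y - a) / r.
have T0 : 0 <= T by rewrite /T !mulr_ge0 ?enorm_ge0// invr_ge0 ltW.
have -> : 1 + - (4 / r ^+ 2) * enorm (y - a) ^+ 2 = 1 - T ^+ 2.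
  by rewrite /T; field; rewrite gt_eqF.
have [T1|T1] := leP T 1; last by rewrite sqplus_npos; [rewrite expr1n subrr expr0n|nra].
have : T ^+ 2 <= 1 by rewrite expr_le1.
rewrite le_eqVlt => /predU1P[->|T2]; first by rewrite subrr sqplus_npos// expr0n.
by rewrite sqplus_pos// subr_gt0.
Qed.

Lemma cutoff_bounds a r y : 0 < r -> 0 <= cutoff a r y <= 1.
Proof.
move=> r0; rewrite cutoffE// sqr_ge0 /=.
set T := Num.min _ _; have : 0 <= T <= 1.
  rewrite /T le_min ge_min lexx orbT ler01 !andbT.
  by rewrite !mulr_ge0 ?enorm_ge0// invr_ge0 ltW.
move=> /andP[T0 T1]; have T2 : T ^+ 2 <= 1 by rewrite expr_le1.
by rewrite expr_le1// ?subr_ge0// gerBl sqr_ge0.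
Qed.

Lemma cutoff_lipschitz a r y z : 0 < r ->
  `|cutoff a r y - cutoff a r z| <= 8 / r * enorm (y - z).
Proof.
move=> r0; rewrite !cutoffE//.
set T := Num.min (2 * enorm (y - a) / r) 1; set S := Num.min (2 * enorm (z - a) / r) 1.
have bd w : 0 <= Num.min (2 * enorm (w - a) / r) 1 <= 1.
  rewrite le_min ge_min lexx orbT ler01 !andbT.
  by rewrite !mulr_ge0 ?enorm_ge0// invr_ge0 ltW.
have /andP[T0 T1] : 0 <= T <= 1 by exact: bd.
have /andP[S0 S1] : 0 <= S <= 1 by exact: bd.
have TS : `|T - S| <= 2 * enorm (y - z) / r.
  have e1 : enorm (y - a) <= enorm (y - z) + enorm (z - a).
    by rewrite (le_trans _ (enormD _ _))// addrA subrK.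
  have e2 : enorm (z - a) <= enorm (y - z) + enorm (y - a).
    by rewrite (enormB y z) (le_trans _ (enormD _ _))// addrA subrK.
  have e3 : 2 * enorm (y - a) / r <= 2 * enorm (y - z) / r + 2 * enorm (z - a) / r.
    by rewrite -mulrDl ler_pM2r ?invr_gt0//; lra.
  have e4 : 2 * enorm (z - a) / r <= 2 * enorm (y - z) / r + 2 * enorm (y - a) / r.
    by rewrite -mulrDl ler_pM2r ?invr_gt0//; lra.
  have e0 : 0 <= 2 * enorm (y - z) / r by rewrite !mulr_ge0 ?enorm_ge0// invr_ge0 ltW.
  rewrite /T /S ler_norml; case: (leP (2 * enorm (y - a) / r) 1) => h1;
    case: (leP (2 * enorm (z - a) / r) 1) => h2; lra.
(* Each factor other than [S - T] is at most 2, whence [4 * (2 / r) = 8 / r]. *)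
have -> : (1 - T ^+ 2) ^+ 2 - (1 - S ^+ 2) ^+ 2 =
  (S - T) * ((S + T) * ((1 - T ^+ 2) + (1 - S ^+ 2))) by ring.
have T2 : T ^+ 2 <= 1 by rewrite expr_le1.
have S2 : S ^+ 2 <= 1 by rewrite expr_le1.
rewrite normrM distrC; have -> : 8 / r * enorm (y - z) = (2 * enorm (y - z) / r) * 4 by ring.
apply: ler_pM => //; have T20 := sqr_ge0 T; have S20 := sqr_ge0 S.
rewrite ger0_norm; last by rewrite mulr_ge0//; lra.
have -> : 4 = 2 * 2 :> R by ring.
apply: ler_pM; lra.
Qed.

Lemma cutoff_out a r y : 0 < r -> r / 2 <= enorm (y - a) -> cutoff a r y = 0.
Proof.
move=> r0 h; rewrite cutoffE// min_r ?expr1n ?subrr ?expr0n//.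
by rewrite ler_pdivlMr// mul1r; lra.
Qed.

Lemma cutoff_center a r : 0 < r -> cutoff a r a = 1.
Proof.
by move=> r0; rewrite cutoffE// subrr enorm0 mulr0 mul0r min_l// expr0n subr0 expr1n.
Qed.

Lemma cutoff_near a r y : 0 < r -> enorm (y - a) <= r / 16 -> 1 / 2 <= cutoff a r y.
Proof.
move=> r0 h; rewrite cutoffE//.
set T := 2 * enorm (y - a) / r.
have T0 : 0 <= T by rewrite /T !mulr_ge0 ?enorm_ge0// invr_ge0 ltW.
have T8 : T <= 1 / 8 by rewrite /T ler_pdivrMr//; lra.
rewrite min_l; last by lra.
have T2 : T ^+ 2 <= 1 / 8 by rewrite expr2; nra.
have T20 := sqr_ge0 T.
set q := T ^+ 2 in T2 T20 *; nra.
Qed.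

Lemma C1_cutoff a r : C1 (cutoff a r) /\ forall i y, partial i (cutoff a r) y =
  - (8 / r ^+ 2) * (1 - 4 / r ^+ 2 * sqdist a y + `|1 - 4 / r ^+ 2 * sqdist a y|) * (y ord0 i - a ord0 i).
Proof.
have [Cq Dq] := @C1_sqdist R d a.
have Cg := C1D (C1_cst 1) (C1M (C1_cst (- (4 / r ^+ 2))) Cq).
have [C D] := C1_comp Cg is_derive_sqplus continuous_sqplus'.
split=> [|i y]; first exact: C.
rewrite [LHS]D (partialD _ _ (C1_cst _) (C1M (C1_cst _) Cq)) (partialM _ _ (C1_cst _) Cq) Dq.
rewrite /partial !derive_cst mulr0 addr0 add0r mulNr; ring.
Qed.

Lemma grad_cutoff a r y : 0 < r -> enorm (grad (cutoff a r) y) ^+ 2 <= 64 / r ^+ 2.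
Proof.
move=> r0; have [_ D] := C1_cutoff a r.
have r2 : 0 < r ^+ 2 by rewrite exprn_gt0.
set T := 1 - 4 / r ^+ 2 * sqdist a y.
have -> : enorm (grad (cutoff a r) y) ^+ 2 = (8 / r ^+ 2 * (T + `|T|)) ^+ 2 * sqdist a y.
  rewrite enorm_gradE /sqdist mulr_sumr; apply: eq_bigr => i _; rewrite D -/T; ring.
have S0 := sqdist_ge0 a y.
have q0 : 0 <= 4 / r ^+ 2 * sqdist a y by rewrite !mulr_ge0// invr_ge0 ltW.
have [T0|T0] := leP T 0.
  by rewrite ler0_norm// subrr mulr0 expr0n mul0r divr_ge0// ltW.
rewrite gtr0_norm//.
have T1 : T <= 1 by rewrite /T; lra.
have S1 : 4 * sqdist a y <= r ^+ 2.
  have : 4 / r ^+ 2 * sqdist a y <= 1 by rewrite /T in T0; lra.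
  by rewrite mulrAC ler_pdivrMr// mul1r.
have -> : (8 / r ^+ 2 * (T + T)) ^+ 2 * sqdist a y = (T ^+ 2 * (4 * sqdist a y / r ^+ 2)) * (64 / r ^+ 2).
  by field; rewrite gt_eqF.
rewrite ler_piMl ?divr_ge0 ?(ltW r2)//.
rewrite mulr_ile1 ?sqr_ge0 ?expr_le1 ?(ltW T0)//.
  by rewrite !mulr_ge0// invr_ge0 ltW.
by rewrite ler_pdivrMr// mul1r.
Qed.
End competitor.

(** * Truncation of the capacity test function; energy and Hoelder bounds *)

Section competitor_energy.
Context {R : realType} {d : nat}.
Implicit Types (F f h phi psi u v : 'rV[R]_d -> R).
Implicit Types (x y z a : 'rV[R]_d) (U D : set 'rV[R]_d) (A : 'rV[R]_d -> 'M[R]_d).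
Local Notation leb := (@lebesgue_rV R d).

(** This is [h(v)] with [h(t) = 1 - ((1 - t^2)_+)^2]: a [C1] function, 0 at 0 and 1 for [|t| >= 1].
    Being even, it needs no sign condition on [v]. *)
Definition trunc v y : R := 1 + -1 * sqplus (1 + -1 * (v y * v y)).

Lemma C1_trunc v : C1 v -> C1 (trunc v) /\ forall i y, partial i (trunc v) y =
  (1 - v y ^+ 2 + `|1 - v y ^+ 2|) * (2 * v y) * partial i v y.
Proof.
move=> Cv; have Cvv := C1M Cv Cv.
have Cg := C1D (C1_cst 1) (C1M (C1_cst (-1)) Cvv).
have [Cs Ds] := C1_comp Cg is_derive_sqplus continuous_sqplus'.
have Cms := C1M (C1_cst (-1)) Cs.
split=> [|i y]; first exact: (C1D (C1_cst 1) Cms).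
rewrite [LHS](partialD _ _ (C1_cst 1) Cms) (partialM _ _ (C1_cst (-1)) Cs) Ds.
rewrite (partialD _ _ (C1_cst 1) (C1M (C1_cst (-1)) Cvv)) (partialM _ _ (C1_cst (-1)) Cvv).
rewrite (partialM _ _ Cv Cv) /partial !derive_cst !mulr0 !addr0 !add0r !mulN1r.
rewrite -expr2; ring.
Qed.

Lemma trunc_eq1 v y : 1 <= v y -> trunc v y = 1.
Proof. by move=> v1; rewrite /trunc sqplus_npos ?mulr0 ?addr0//; nra. Qed.

Lemma trunc_sqr v y : trunc v y ^+ 2 <= 4 * v y ^+ 2.
Proof.
rewrite /trunc /sqplus; case: ifPn => [T0|T0].
  have -> : 1 + -1 * (1 + -1 * (v y * v y)) ^+ 2 = v y ^+ 2 * (2 - v y ^+ 2) by ring.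
  rewrite exprMn; have : v y ^+ 2 < 1 by rewrite expr2; lra.
  have := sqr_ge0 (v y); set V := v y ^+ 2 => V0 V1.
  have V2 : (2 - V) ^+ 2 <= 4 by rewrite expr2; nra.
  rewrite mulrC; apply: ler_pM => //; first exact: sqr_ge0.
    exact: sqr_ge0.
  by rewrite expr2; nra.
by rewrite mulr0 addr0 expr1n; move: T0; rewrite -leNgt expr2; nra.
Qed.

Lemma grad_trunc v y : C1 v -> enorm (grad (trunc v) y) ^+ 2 <= 16 * enorm (grad v y) ^+ 2.
Proof.
move=> Cv; have [_ D] := C1_trunc Cv.
rewrite !enorm_gradE mulr_sumr; apply: ler_sum => i _; rewrite D exprMn.
rewrite ler_wpM2r ?sqr_ge0//.
have [T0|T0] := leP (1 - v y ^+ 2) 0.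
  by rewrite ler0_norm// subrr mul0r expr0n.
rewrite gtr0_norm//; have V0 := sqr_ge0 (v y).
have -> : ((1 - v y ^+ 2 + (1 - v y ^+ 2)) * (2 * v y)) ^+ 2 = 16 * ((1 - v y ^+ 2) ^+ 2 * v y ^+ 2) by ring.
set V := v y ^+ 2 in T0 V0 *.
have : (1 - V) ^+ 2 * V <= 1.
  have h2 : (1 - V) ^+ 2 <= 1 by rewrite expr_le1 ?(ltW T0)//; lra.
  have V1 : V <= 1 by lra.
  by rewrite -[leRHS]mulr1; exact: (ler_pM (sqr_ge0 _) V0 h2 V1).
lra.
Qed.

(** The product rule gives [32 |grad v|^2 + (512 / r^2) v^2]. As [v] vanishes outside [B(a,2r)],
    Hardy's inequality on that ball bounds the integral of [v^2] by [32 r^2] times the energy, and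
    [16416 = 32 + 512 * 32]. *)
Lemma competitor_energy a r v : (2 < d)%N -> 0 < r -> test_function (eball a (2 * r)) v ->
  let F y := cutoff a r y * trunc v y in
  [/\ C1 F, boxed (enorm a + r) F &
  (\int[leb]_x (enorm (grad F x) ^+ 2)%:E <=
   16416%:E * \int[leb]_(x in eball a (2 * r)) (enorm (grad v x) ^+ 2)%:E)%E].
Proof.
move=> d2 r0 tv F; have Cv := test_C1 tv; have [Mv bv] := test_boxed tv.
have [Cf Df] := @C1_cutoff R d a r; have [Ct Dt] := C1_trunc Cv.
have r2 : 0 < r ^+ 2 by rewrite exprn_gt0.
have CF : C1 F by exact: (C1M Cf Ct).
split=> //.
  move=> y i yi; rewrite /F cutoff_out ?mul0r//.
  have := coord_le_enorm (y - a) i; rewrite !mxE.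
  have := coord_le_enorm a i; have := ler_distD (a ord0 i) (y ord0 i) 0.
  rewrite !subr0; lra.
have key x : enorm (grad F x) ^+ 2 <= 32 * enorm (grad v x) ^+ 2 + 512 / r ^+ 2 * v x ^+ 2.
  have -> : grad F x = cutoff a r x *: grad (trunc v) x + trunc v x *: grad (cutoff a r) x.
    by apply/rowP => i; rewrite !mxE (partialM _ _ Cf Ct).
  apply: le_trans (enorm_sqrD _ _) _.
  have enZ (c : R) (w : 'rV[R]_d) : enorm (c *: w) ^+ 2 = c ^+ 2 * enorm w ^+ 2.
    by rewrite !enormE mulr_sumr; apply: eq_bigr => i _; rewrite !mxE exprMn.
  rewrite !enZ; apply: lerD.
    have /andP[c0 c1] := cutoff_bounds a x r0.
    have : cutoff a r x ^+ 2 * enorm (grad (trunc v) x) ^+ 2 <= 1 * (16 * enorm (grad v x) ^+ 2).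
      by apply: ler_pM; rewrite ?sqr_ge0 ?expr_le1//; exact: grad_trunc.
    lra.
  have : trunc v x ^+ 2 * enorm (grad (cutoff a r) x) ^+ 2 <= 4 * v x ^+ 2 * (64 / r ^+ 2).
    by apply: ler_pM; rewrite ?sqr_ge0 ?trunc_sqr ?grad_cutoff.
  have -> : 512 / r ^+ 2 * v x ^+ 2 = 2 * (4 * v x ^+ 2 * (64 / r ^+ 2)) by ring.
  lra.
have mb := measurable_open (@open_eball R d a (2 * r)).
have iv := integrable_grad_sqr Cv bv.
have EE : (\int[leb]_(x in eball a (2 * r)) (enorm (grad v x) ^+ 2)%:E =
    \int[leb]_x (enorm (grad v x) ^+ 2)%:E)%E.
  rewrite [LHS]integral_mkcond; apply: eq_integral => x _; rewrite patchE.
  case: ifPn => // /negP; rewrite inE => nD; rewrite enorm_gradE big1// => i _.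
  by rewrite (test_out tv nD).2 expr0n.
have vv : (\int[leb]_x (v x ^+ 2)%:E <= (32 * r ^+ 2)%:E * \int[leb]_x (enorm (grad v x) ^+ 2)%:E)%E.
  have r20 : 0 < 2 * r by rewrite mulr_gt0.
  have := hardy_ball a d2 r20 Cv bv.
  have -> : 8 * (2 * r) ^+ 2 = 32 * r ^+ 2 by ring.
  apply: le_trans; rewrite [leRHS]integral_mkcond le_eqVlt; apply/orP; left; apply/eqP.
  apply: eq_integral => x _; rewrite patchE.
  by case: ifPn => // /negP; rewrite inE => nD; rewrite (test_out tv nD).1 expr0n.
have iv2 : leb.-integrable setT (fun x : borel R d => (v x ^+ 2)%:E).
  by apply: (@boxed_integrable _ _ Mv); [exact: (contM Cv.1 Cv.1)|exact: (boxedM v bv)].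
apply: (@le_trans _ _ (\int[leb]_x (32%:E * (enorm (grad v x) ^+ 2)%:E + (512 / r ^+ 2)%:E * (v x ^+ 2)%:E))%E).
  apply: ge0_le_integral => //.
  - by move=> x _; rewrite lee_fin sqr_ge0.
  - by apply/measurable_EFinP; exact: measurable_continuous (continuous_grad_sqr CF).
  - apply: emeasurable_funD; apply: measurable_funeM; apply/measurable_EFinP.
      exact: measurable_continuous (continuous_grad_sqr Cv).
    exact: measurable_continuous (contM Cv.1 Cv.1).
  - by move=> x _; rewrite -!EFinM -EFinD lee_fin; exact: key.
rewrite integralD//; [|exact: integrableZl|exact: integrableZl].
rewrite !integralZl// EE.
move: vv; rewrite -(fineK (integrable_fin_num measurableT iv)) -(fineK (integrable_fin_num measurableT iv2)).
set J := fine _; set I := fine _.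
rewrite -!EFinM !lee_fin => JI.
have : 512 / r ^+ 2 * J <= 512 / r ^+ 2 * (32 * r ^+ 2 * I).
  exact: (ler_wpM2l (divr_ge0 (ler0n _ 512) (ltW r2)) JI).
have -> : 512 / r ^+ 2 * (32 * r ^+ 2 * I) = 16384 * I by field; rewrite gt_eqF.
lra.
Qed.

(** Interpolation between the Lipschitz bound [X] and the oscillation bound 1: the minimum of [X]
    and 1 is at most [X^alpha]. *)
Lemma hoelder_cutoff (alpha : R) a r (S : set 'rV[R]_d) : 0 < alpha < 1 -> 0 < r ->
  (hoelder_seminorm alpha S (cutoff a r) <= ((8 / r) `^ alpha)%:E)%E.
Proof.
move=> /andP[a0 a1] r0; apply: ge_ereal_sup => _ [->|[[y z] [/= Sy Sz yz] <-]].
  by rewrite lee_fin powR_ge0.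
rewrite lee_fin.
have e0 : 0 < enorm (y - z).
  rewrite lt_neqAle enorm_ge0 andbT eq_sym; apply: contra_neq yz => /enorm_eq0/eqP.
  by rewrite subr_eq0 => /eqP.
rewrite ler_pdivrMr ?powR_gt0// -powRM ?enorm_ge0//; last by rewrite divr_ge0// ltW.
set X := 8 / r * enorm (y - z).
have X0 : 0 <= X by rewrite mulr_ge0 ?enorm_ge0// divr_ge0// ltW.
have D1 : `|cutoff a r y - cutoff a r z| <= X by exact: cutoff_lipschitz.
have D2 : `|cutoff a r y - cutoff a r z| <= 1.
  have /andP[y0 y1] := cutoff_bounds a y r0; have /andP[z0 z1] := cutoff_bounds a z r0.
  by rewrite ler_norml; lra.
have [X1|X1] := leP X 1.
  apply: le_trans D1 _; have [->|Xn0] := eqVneq X 0; first by rewrite powR_ge0.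
  by apply: ger1_powR; [rewrite X1 andbT lt_neqAle X0 andbT eq_sym|exact: ltW].
apply: le_trans D2 _; rewrite -(powRr0 X); apply: ler_powR; exact: ltW.
Qed.
End competitor_energy.

(** * Lower bound for the capacity *)

Section capacity_density_proof.
Context {R : realType} {d : nat}.
Implicit Types (F f h phi psi u v : 'rV[R]_d -> R).
Implicit Types (x y z a : 'rV[R]_d) (U D Omega : set 'rV[R]_d) (A : 'rV[R]_d -> 'M[R]_d).
Local Notation leb := (@lebesgue_rV R d).

Lemma bd_notin Omega y : open Omega -> bd Omega y -> ~ Omega y.
Proof. by move=> oO [_ +] Oy; apply; exact: open_nbhs_nbhs. Qed.

Lemma elliptic_subset Lambda Omega D A : open Omega -> D `<=` Omega ->
  measurable (D : set (borel R d)) -> elliptic Lambda Omega A -> elliptic Lambda D A.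
Proof.
move=> oO DO mD [mA eA]; split.
  by move=> i j; exact: (measurable_funS (measurable_open oO) DO (mA i j)).
apply: (@filterS _ (almost_everywhere leb)) eA => X h DX; exact: h (DO _ DX).
Qed.

Lemma hoelder_le (alpha : R) D u (K : R) X Y :
  (hoelder_seminorm alpha D u <= K%:E)%E -> 0 <= K -> D X -> D Y ->
  `|u X - u Y| <= K * enorm (X - Y) `^ alpha.
Proof.
move=> uK K0 DX DY; have [->|XY] := eqVneq X Y.
  by rewrite subrr normr0 mulr_ge0 ?powR_ge0.
have e0 : 0 < enorm (X - Y).
  rewrite lt_neqAle enorm_ge0 andbT eq_sym; apply: contra_neq XY => /enorm_eq0/eqP.
  by rewrite subr_eq0 => /eqP.
rewrite -ler_pdivrMr ?powR_gt0// -lee_fin; apply: le_trans uK.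
by apply: ereal_sup_ubound; right; exists (X, Y).
Qed.

Lemma far_point (S : set 'rV[R]_d) x (r : R) : (r%:E < ediam S)%E ->
  exists2 y, S y & r / 2 <= enorm (y - x).
Proof.
move=> /ereal_sup_gt[_ [y Sy [z Sz <-]]]; rewrite lte_fin => ryz.
have [h|h] := leP (r / 2) (enorm (y - x)); first by exists y.
exists z => //; have := enormD (y - x) (x - z).
by rewrite addrA subrK (enormB x z); lra.
Qed.

Lemma closure_meet D x (P : set 'rV[R]_d) : closure D x -> nbhs x P -> exists2 y, D y & P y.
Proof. by move=> cx /cx[y [Dy Py]]; exists y. Qed.

(** The only place where [alpha] and [C] determine a scale. [|C| + 1] makes the choice valid for any
    real [C] and ensures [t <= 1]. *)
Lemma small_scale (alpha C : R) : 0 < alpha < 1 -> exists2 t : R, 0 < t <= 1 &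
  forall z : R, 0 <= z <= t -> `|C| * z `^ alpha <= 1 / 4.
Proof.
move=> /andP[a0 a1]; pose B := 4 * (`|C| + 1).
have B1 : 1 <= B by rewrite /B; have := normr_ge0 C; lra.
have B0 : 0 < B by lra.
exists (B^-1 `^ alpha^-1).
  rewrite powR_gt0 ?invr_gt0//=.
  rewrite -(powRr0 B^-1); apply: ger_powR; last by rewrite invr_ge0 ltW.
  by rewrite invr_gt0 B0 invf_le1.
move=> z /andP[z0 zt].
have : z `^ alpha <= B^-1.
  apply: (@le_trans _ _ ((B^-1 `^ alpha^-1) `^ alpha)).
    by apply: ge0_ler_powR; rewrite ?nnegrE ?powR_ge0// ltW.
  by rewrite -powRrM mulVf ?gt_eqF// powRr1// invr_ge0 ltW.
move=> h; apply: (@le_trans _ _ (`|C| * B^-1)); first by rewrite ler_wpM2l.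
by rewrite ler_pdivrMr// /B; have := normr_ge0 C; lra.
Qed.

(** The Hoelder bound concerns points of [Omega] only, so [x] is first replaced by a nearby [Y] in
    [Omega], at a loss of 1/8 by continuity of the extension. The distance from [X] to [Y] is at
    most [t r / 8], so that after the factor [8 / r] of the bump it is at most [t] and costs 1/4. *)
Lemma solution_near_center (alpha C t : R) Omega A u x (r : R) : 0 < alpha < 1 -> 0 < r ->
  0 < t <= 1 -> (forall z : R, 0 <= z <= t -> `|C| * z `^ alpha <= 1 / 4) ->
  bd Omega x -> hoelder_solution A Omega alpha C (cutoff x r) u ->
  forall X, Omega X -> eball x (t / 16 * r) X -> 5 / 8 <= u X.
Proof.
move=> a01 r0 /andP[t0 t1] Ct bx [_ _ [U [cU Uu Ubd]] us] X OX xX.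
pose s := t / 16 * r; have s0 : 0 < s by rewrite /s mulr_gt0// divr_gt0.
have r8 : 0 <= 8 / r by rewrite divr_ge0// ltW.
have uK : (hoelder_seminorm alpha Omega u <= (`|C| * (8 / r) `^ alpha)%:E)%E.
  apply: le_trans us _.
  have hf := hoelder_cutoff x (bd Omega) a01 r0.
  have hf0 : (0 <= hoelder_seminorm alpha (bd Omega) (cutoff x r))%E.
    by apply: ereal_sup_ubound; left.
  rewrite EFinM; apply: (@le_trans _ _ (`|C|%:E * hoelder_seminorm alpha (bd Omega) (cutoff x r))%E).
    by apply: lee_wpmul2r => //; rewrite lee_fin ler_norm.
  by apply: lee_wpmul2l => //; rewrite lee_fin.
have clx : closure Omega x by case: bx.
have Ux : U x = 1 by rewrite Ubd// cutoff_center.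
have cx : U @ within (closure Omega) (nbhs x) --> U x by move/subspace_continuousP : cU => /(_ _ clx).
have near1 : \forall y \near x, closure Omega y -> `|U x - U y| < 1 / 8.
  have : \forall y \near within (closure Omega) (nbhs x), `|U x - U y| < 1 / 8.
    by apply: (@cvgr_dist_lt _ _ _ _ _ _ _ cx); lra.
  by rewrite near_withinE.
have near2 : nbhs x (eball x s).
  by apply: open_nbhs_nbhs; split; [exact: open_eball|rewrite /eball /= subrr enorm0].
have [Y OY [Y1 Y2]] := closure_meet clx (filterI near1 near2).
have := Y1 (subset_closure OY); rewrite Ux Uu// => uY.
have XY : enorm (X - Y) <= 2 * s.
  have := enormD (X - x) (x - Y); rewrite addrA subrK (enormB x Y) => h.
  by move: xX Y2; rewrite /eball /= -/s; lra.
have := hoelder_le uK (mulr_ge0 (normr_ge0 C) (powR_ge0 _ _)) OX OY.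
rewrite -mulrA -powRM ?enorm_ge0// => hXY.
have : `|C| * (8 / r * enorm (X - Y)) `^ alpha <= 1 / 4.
  apply: Ct; rewrite mulr_ge0 ?enorm_ge0//=.
  apply: (@le_trans _ _ (8 / r * (2 * s))); first by rewrite ler_wpM2l.
  by rewrite le_eqVlt; apply/orP; left; apply/eqP; rewrite /s; field; rewrite gt_eqF.
move: uY hXY; rewrite !ler_norml ltr_norml; lra.
Qed.

Lemma lebesgue_eball_ge x (s : R) : (0 < d)%N -> 0 < s ->
  (((s / d%:R) ^+ d)%:E <= leb (eball x s))%E.
Proof.
move=> d0 s0; have dR : 0 < d%:R :> R by rewrite ltr0n.
(* Half the side of a cube that fits into the ball: the squared distance to its centre is at most
   [d q^2 = s^2 / (4 d)]. *)
pose q := s / (2 * d%:R).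
have q0 : 0 <= q by rewrite /q divr_ge0 ?mulr_ge0// ltW.
have -> : s / d%:R = 2 * q by rewrite /q; field; rewrite gt_eqF.
rewrite -(lebesgue_cbox x q0); apply: le_measure; rewrite ?inE.
- exact: measurable_cbox.
- exact: measurable_open (@open_eball R d x s).
- move=> y /cboxP yq; apply/eballE; first exact: ltW.
  apply: (@le_lt_trans _ _ (\sum_(i < d) q ^+ 2)).
    apply: ler_sum => i _; rewrite -(real_normK (num_real (_ - _))).
    by rewrite ler_pXn2r ?nnegrE.
  rewrite sumr_const card_ord -mulr_natl /q.
  have -> : d%:R * (s / (2 * d%:R)) ^+ 2 = s ^+ 2 * (4 * d%:R)^-1 by field; rewrite gt_eqF.
  have d1 : 1 <= d%:R :> R by rewrite ler1n.
  by rewrite gtr_pMr ?exprn_gt0// invf_lt1; lra.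
Qed.
End capacity_density_proof.

(** * From elliptic measure to a lower bound for the energy of the datum *)

Section lower_bound.
Context {R : realType} {d : nat}.
Implicit Types (F u : 'rV[R]_d -> R).
Implicit Types (x y : 'rV[R]_d) (Omega : set 'rV[R]_d) (A : 'rV[R]_d -> 'M[R]_d).
Implicit Types (w : 'rV[R]_d -> {measure set (borel R d) -> \bar R}).
Local Notation leb := (@lebesgue_rV R d).

Lemma bd_DN Omega (N : nat) y : open Omega ->
  bd (Omega `&` eball 0 N%:R) y -> ~ bd Omega y -> N%:R <= enorm y.
Proof.
move=> oO [cy iy] nb; rewrite leNgt; apply/negP => yN.
have Oy : Omega y.
  apply: contrapT => nO; apply: nb; split.
    by apply: closureS cy; exact: subIsetl.
  by move=> /interior_subset.
apply: iy; apply: open_nbhs_nbhs; split.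
  by apply: openI => //; exact: open_eball.
by split => //; rewrite /eball /= subr0.
Qed.

(* In the unbounded case both clauses of [elliptic_measure] are applied to [F]
   itself: it vanishes on the part of the boundary of the truncated domains that
   lies outside [bd Omega]. *)
Lemma elliptic_measure_energy_bound (Lambda : R) Omega A w F u x (r s M : R) :
  (2 < d)%N -> 1 <= Lambda -> open Omega -> elliptic Lambda Omega A ->
  elliptic_measure A Omega w -> C1 F -> boxed M F -> 0 < s ->
  (forall y, enorm x + r <= enorm y -> F y = 0) ->
  (forall y, eball x s y -> ~ Omega y -> 1 / 2 <= F y) ->
  (forall y, Omega y -> eball x s y -> 5 / 8 <= u y) ->
  (forall y, Omega y -> (\int[w y]_(z in bd Omega) (F z)%:E = (u y)%:E)%E) ->
  (4^-1%:E * leb (eball x s) <=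
   (96 * s ^+ 2 * Lambda ^+ 4)%:E * \int[leb]_x (enorm (grad F x) ^+ 2)%:E)%E.
Proof.
move=> d2 L1 oO ellA [wb wu] CF bF s0 Fout Fs us uE.
have [bO|nbO] := pselect (bounded_set Omega).
  have [u' [_ su' vu'] u'E] := wb bO F (boxed_lipschitz (bd Omega) CF bF).
  (* For bounded [Omega] the sequence of domains and solutions is constant. *)
  apply: (@liminf_bound _ _ _ (fun=> Omega) A M F (fun=> u')) => //.
    by move=> _; apply: vu' => //; exact: boxed_lipschitz bF.
  move=> y ys; near=> N; rewrite patchE; case: ifPn => [|/negP]; rewrite inE => Oy.
    have [E] : (u y)%:E = (u' y)%:E by rewrite -uE// u'E.
    by rewrite /= addrC subrK -E; have := us _ Oy ys; lra.
  (* Outside its set a restriction takes the default value of [R], which is 0, so only [F] is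
     left. *)
  have -> : (point : R) = 0 by [].
  by rewrite addr0; exact: Fs.
have [wN wNb wNcvg] := wu nbO.
pose DN (N : nat) := Omega `&` eball (0 : 'rV[R]_d) N%:R.
have oDN N : open (DN N) by apply: openI => //; exact: open_eball.
have sol N : exists u', variational_solution A (DN N) F u' /\
    forall X, DN N X -> (\int[wN N X]_(y in bd (DN N)) (F y)%:E = (u' X)%:E)%E.
  by have [u' ? ?] := wNb N F (boxed_lipschitz _ CF bF); exists u'.
have [u_ Hu] := choice sol.
apply: (@liminf_bound _ _ _ DN A M F u_) => //.
- by move=> N; apply: elliptic_subset ellA => //; [exact: subIsetl|exact: measurable_open].
- by move=> N; have [[]] := Hu N.
- move=> N; have [[_ _ vs] _] := Hu N.
  by apply: vs => //; exact: boxed_lipschitz bF.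
move=> y ys.
have [Oy|nOy] := pselect (Omega y); last first.
  near=> N; rewrite patchE; case: ifPn => [|/negP]; rewrite inE => Dy.
    by case: Dy => /nOy.
  have -> : (point : R) = 0 by [].
  by rewrite addr0; exact: Fs.
have cF : compact (closure [set z | bd Omega z /\ F z != 0]).
  apply: (@subclosed_compact _ _ (cube M)); [exact: closed_closure|exact: compact_cube|].
  rewrite closureE => z; apply; split.
    by apply: compact_closed; [exact: norm_hausdorff|exact: compact_cube].
  by move=> q [_ /eqP Fq]; apply: contrapT => nc; apply: Fq; exact: (boxedP _ _).1 nc.
have := wNcvg y F Oy (boxed_lipschitz _ CF bF) cF.
rewrite uE// => cv.
have near_u : \forall N \near \oo, DN N y /\
    (\int[wN N y]_(z in bd (DN N)) ((F \_ (bd Omega)) z)%:E = (u_ N y)%:E)%E.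
  near=> N.
  have DNy : DN N y.
    split => //; rewrite /eball /= subr0; apply: (@lt_le_trans _ _ (enorm y + 1)); first by rewrite ltrDl.
    near: N; exact: nbhs_infty_ger.
  split => //; have [_ <-//] := Hu N.
  apply: eq_integral => z; rewrite inE => bz; congr EFin; rewrite patchE.
  case: ifPn => // /negP; rewrite inE => nbz.
  apply/esym/Fout; apply: le_trans (bd_DN oO bz nbz).
  near: N; exact: nbhs_infty_ger.
have cu : u_ N y @[N --> \oo] --> u y.
  have : (u_ N y)%:E @[N --> \oo] --> (u y)%:E.
    apply: cvg_trans cv; apply: near_eq_cvg.
    by apply: filterS near_u => N [_ ->].
  by move=> /fine_cvgP[].
(* The margin between 5/8 and 1/2 lets the lower bound pass from the limit to the approximating
   solutions. *)
have u12 : 1 / 2 < u y by have := us _ Oy ys; lra.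
have nu : \forall N \near \oo, 1 / 2 < u_ N y by apply: (@cvgr_gt _ _ _ _ _ _ cu).
apply: filterS2 near_u nu => N [DNy _] uN.
by rewrite patchE mem_set//= addrC subrK ltW.
Unshelve. all: end_near. Qed.
End lower_bound.

Theorem theorem1p10 (R : realType) (n : nat) (Lambda alpha C : R) :
  (2 <= n)%N -> 1 <= Lambda -> 0 < alpha < 1 ->
  exists2 c : R, 0 < c &
  forall (Omega : set 'rV[R]_n.+1) (A : 'rV[R]_n.+1 -> 'M[R]_n.+1)
    (w : 'rV[R]_n.+1 -> {measure set (borel R n.+1) -> \bar R}),
  open Omega -> elliptic Lambda Omega A -> elliptic_measure A Omega w ->
  (forall f : 'rV[R]_n.+1 -> R, hoelder_class alpha (bd Omega) f ->
     (bounded_set Omega \/ ~ bounded_set Omega /\ ~ bounded_set (bd Omega) ->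
        (forall X, Omega X -> (w X).-integrable (bd Omega) (EFin \o f)) /\
        hoelder_solution A Omega alpha C f
          (fun X => \int[w X]_(y in bd Omega) f y)) /\
     (~ bounded_set Omega /\ bounded_set (bd Omega) ->
        forall y0, bd Omega y0 ->
        (forall X, Omega X ->
           (w X).-integrable (bd Omega) (fun y => (f y - f y0)%:E)) /\
        hoelder_solution A Omega alpha C f
          (fun X => f y0 + \int[w X]_(y in bd Omega) (f y - f y0)))) ->
  capacity_density c Omega.
Proof.
move=> n2 L1 a01.
have [cb cb0 capB] := @capacity_eball_le R n.+1.
have [t /andP[t0 t1] Ct] := small_scale C a01.
pose delta := t / 16.
have delta0 : 0 < delta by rewrite divr_gt0.
have [k k0 compE] : exists2 k : R, 0 < k & forall x r (v : 'rV[R]_n.+1 -> R), 0 < r ->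
    test_function (eball x (2 * r)) v -> let F y := cutoff x r y * trunc v y in
    [/\ C1 F, boxed (enorm x + r) F &
    (\int[lebesgue_rV n.+1]_y (enorm (grad F y) ^+ 2)%:E <=
     k%:E * \int[lebesgue_rV n.+1]_(y in eball x (2 * r)) (enorm (grad v y) ^+ 2)%:E)%E].
  by exists 16416; [exact: ltr0Sn|move=> x r v; exact: competitor_energy].
(* Solving [(1/4) (s/d)^d <= 96 s^2 Lambda^4 k E] with [s = delta r] and [d = n.+1] for the energy
   [E] of [v] gives [E >= c1 r^(d-2)]. *)
pose K := 4 * (96 * delta ^+ 2 * Lambda ^+ 4 * k).
have L0 : 0 < Lambda by exact: lt_le_trans L1.
have K0 : 0 < K by rewrite /K !mulr_gt0.
pose c1 := (delta / n.+1%:R) ^+ n.+1 / K.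
have c10 : 0 < c1 by rewrite divr_gt0// exprn_gt0// divr_gt0.
exists (c1 / cb); first by rewrite divr_gt0.
move=> Omega A w oO ellA mw hyp x r bx r0 rdiam.
have r2 : 0 < r ^+ 2 by rewrite exprn_gt0.
suff low v : test_function (eball x (2 * r)) v ->
    (forall y, (closure (eball x r) `\` Omega) y -> 1 <= v y) ->
    ((c1 * (r ^+ n.+1 / r ^+ 2))%:E <=
      \int[lebesgue_rV n.+1]_(y in eball x (2 * r)) (enorm (grad v y) ^+ 2)%:E)%E.
  apply: (@le_trans _ _ (c1 * (r ^+ n.+1 / r ^+ 2))%:E).
    have -> : c1 * (r ^+ n.+1 / r ^+ 2) = c1 / cb * (cb * r ^+ n.+1 / r ^+ 2).
      by field; rewrite !gt_eqF.
    rewrite (EFinM (c1 / cb)); apply: lee_wpmul2l; last exact: capB.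
    by rewrite lee_fin divr_ge0 ?ltW.
  by apply: le_ereal_inf_tmp => _ [v [tv v1] <-]; exact: low.
move=> tv v1.
have [CF bF EF] := compE _ _ _ r0 tv.
set F := (fun y => _) in CF bF EF.
(* With [y0] off the support of [f], the expression for bounded boundary, [f y0] plus the integral
   of [f - f y0], is again the integral of [f]. *)
have [y0 by0 y0r] := far_point x rdiam.
pose f := cutoff x r.
have fy0 : f y0 = 0 by exact: cutoff_out.
have hf : hoelder_class alpha (bd Omega) f.
  by apply: le_lt_trans (hoelder_cutoff x (bd Omega) a01 r0) _; rewrite ltry.
pose u X := \int[w X]_(y in bd Omega) f y.
have [intf solu] : (forall X, Omega X -> (w X).-integrable (bd Omega) (EFin \o f)) /\
    hoelder_solution A Omega alpha C f u.
  have [h1 h2] := hyp f hf.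
  have [bO|nbO] := pselect (bounded_set Omega); first by apply: h1; left.
  have [bb|nbb] := pselect (bounded_set (bd Omega)); last by apply: h1; right.
  have [] := h2 (conj nbO bb) y0 by0.
  have -> : (fun X => f y0 + \int[w X]_(y in bd Omega) (f y - f y0)) = u.
    by apply/funext => X; rewrite fy0 add0r; under eq_Rintegral do rewrite subr0.
  move=> h3 h4; split => // X OX; have := h3 X OX.
  by under eq_fun do rewrite fy0 subr0.
have u58 := solution_near_center a01 r0 (introT andP (conj t0 t1)) Ct bx solu.
pose s := delta * r; have s0 : 0 < s by rewrite mulr_gt0.
have cl y : enorm (y - x) < r -> closure (eball x r) y by move=> yr; exact: subset_closure.
(* Off [B(x,r/2)] both sides vanish. Inside, [y] is not in the open set [Omega], so [v y >= 1] and
   the truncation is 1. *)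
have Fbd y : bd Omega y -> F y = f y.
  move=> by_; rewrite /F -/f.
  have [h|h] := leP (r / 2) (enorm (y - x)); first by rewrite /f cutoff_out// mul0r.
  rewrite trunc_eq1 ?mulr1//; apply: v1; split; last exact: bd_notin by_.
  by apply: cl; lra.
(* Absolute convergence is used here: without it the real-valued integral would not determine the
   extended one. *)
have uF X : Omega X -> (\int[w X]_(z in bd Omega) (F z)%:E = (u X)%:E)%E.
  move=> OX; have mbd : measurable (bd Omega : set (borel R n.+1)).
    apply: measurableD; first by apply: measurable_closed; exact: closed_closure.
    by apply: measurable_open; exact: open_interior.
  rewrite /u /Rintegral fineK; last exact: (integrable_fin_num mbd (intf X OX)).
  by apply: eq_integral => z; rewrite inE => bz; rewrite Fbd.
have Fout y : enorm x + r <= enorm y -> F y = 0.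
  move=> h; rewrite /F cutoff_out ?mul0r//.
  have := enormD (y - x) x; rewrite subrK; lra.
have Fs y : eball x s y -> ~ Omega y -> 1 / 2 <= F y.
  rewrite /eball /= => ys nO; have sr : s <= r / 16.
    by rewrite /s /delta mulrAC ler_pM2r ?invr_gt0// ler_piMl// ltW.
  rewrite /F trunc_eq1 ?mulr1; first by apply: cutoff_near => //; lra.
  by apply: v1; split => //; apply: cl; lra.
have := @elliptic_measure_energy_bound R n.+1 Lambda Omega A w F u x r s _ n2 L1 oO ellA mw CF bF s0 Fout Fs u58 uF.
have [Mv bv] := test_boxed tv.
have iv : (\int[lebesgue_rV n.+1]_(y in eball x (2 * r)) (enorm (grad v y) ^+ 2)%:E)%E \is a fin_num.
  apply: (integrable_fin_num (measurable_open (@open_eball R n.+1 x (2 * r)))).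
  apply: (integrableS measurableT (measurable_open (@open_eball R n.+1 x (2 * r))) (@subsetT _ _)).
  exact: integrable_grad_sqr (test_C1 tv) bv.
move: EF; rewrite -(fineK iv); set E := fine _ => EF lowB.
have k1 : (0 <= (96 * s ^+ 2 * Lambda ^+ 4)%:E :> \bar R)%E.
  by rewrite lee_fin ltW// !mulr_gt0.
have ballge := lebesgue_eball_ge x (ltn0Sn n) s0.
have q0 : (0 <= (4^-1)%:E :> \bar R)%E by rewrite lee_fin invr_ge0.
have := le_trans (lee_wpmul2l q0 ballge) (le_trans lowB (lee_wpmul2l k1 EF)).
rewrite -!EFinM !lee_fin => fin.
rewrite /c1 mulrAC ler_pdivrMr//.
have -> : (delta / n.+1%:R) ^+ n.+1 * (r ^+ n.+1 / r ^+ 2) = (s / n.+1%:R) ^+ n.+1 / r ^+ 2.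
  by rewrite mulrA -exprMn /s mulrAC.
rewrite ler_pdivrMr//.
have -> : E * K * r ^+ 2 = 4 * (96 * s ^+ 2 * Lambda ^+ 4 * (k * E)) by rewrite /K /s; ring.
by rewrite mulrC -ler_pdivlMr// mulrC in fin *; lra.
Qed.
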